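(* Let $n\ge5$. Let $F$ be any one of the monodromy invariants $O_1,\dots,O_{[n/2]},O_n,E_1,\dots,E_{[n/2]},E_n$ on the space $\mathcal P_n$ of twisted $n$-gons. Then the Hamiltonian vector field $X_F$ on $\mathcal P_n$ is tangent to the subspace $\mathcal C_n\subset\mathcal P_n$ of closed $n$-gons (at every smooth point of $\mathcal C_n$).
   Context: The ground field is $\mathbb R$ or $\mathbb C$. A twisted $n$-gon is a map $\mathbb Z\to\mathbb P^2$, $i\mapsto v_i$, with $v_{i+n}=M(v_i)$ for all $i$ and a fixed $M\in\mathrm{PGL}_3$, called the monodromy. $\mathcal P_n$ is the space of (generic) twisted $n$-gons modulo projective equivalence. $\mathcal C_n\subset\mathcal P_n$ is the subvariety, of codimension $8$, of classes of closed $n$-gons, i.e. those with $M=\mathrm{Id}$. Corner invariants: for collinear points with affine parameters $t_i$, $[t_1,t_2,t_3,t_4]=\frac{(t_1-t_2)(t_3-t_4)}{(t_1-t_3)(t_2-t_4)}$. With $(v,w)$ the line through $v,w$, $$x_{2i-1}=[v_{i-2},v_{i-1},(v_{i-2},v_{i-1})\cap(v_i,v_{i+1}),(v_{i-2},v_{i-1})\cap(v_{i+1},v_{i+2})],$$ $$x_{2i}=[v_{i+2},v_{i+1},(v_{i+2},v_{i+1})\cap(v_i,v_{i-1}),(v_{i+2},v_{i+1})\cap(v_{i-1},v_{i-2})].$$ Indices are modulo $2n$; $(x_1,\dots,x_{2n})$ are local coordinates on $\mathcal P_n$. Poisson bracket on $\mathcal P_n$: $\{x_i,x_{i+2}\}=(-1)^i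 x_ix_{i+2}$, and $\{x_i,x_j\}=0$ unless $i-j\equiv\pm2 \pmod{2n}$. The Hamiltonian vector field $X_f$ of a function $f$ is defined by $X_f(g)=\{f,g\}$ for all $g$. Monodromy invariants: put $X_i=x_{i-1}x_ix_{i+1}$. For $1\le k\le[n/2]$, $O_k=\sum(-1)^t X_{i_1}\cdots X_{i_s}x_{j_1}\cdots x_{j_t}$, the sum over all sets of distinct even indices $\{i_1,\dots,i_s\}$ and distinct odd indices $\{j_1,\dots,j_t\}$ (modulo $2n$) with $s+t=k$ that are admissible: no two even indices differ by $\pm2,\pm4$, no two odd indices differ by $\pm2$, and no even index and odd index differ by $\pm1,\pm3$ modulo $2n$ (i.e. all the factors $X_{i_r},x_{j_u}$ pairwise Poisson commute). $E_k$ is defined identically with the roles of even and odd exchanged. Also $O_n=x_1x_3\cdots x_{2n-1}$ and $E_n=x_2x_4\cdots x_{2n}$. *)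

(* Defs.v *)
From HB Require Import structures.
From mathcomp Require Import all_boot all_order all_algebra.
From mathcomp Require Import complex.
From mathcomp Require Import all_classical all_reals all_analysis.

Set Implicit Arguments.
Unset Strict Implicit.
Unset Printing Implicit Defensive.

Import Order.TTheory GRing.Theory Num.Theory.
Import numFieldNormedType.Exports.

Local Open Scope classical_set_scope.
Local Open Scope ring_scope.

(* Corner coordinates (x_1, ..., x_2n) on the space P_n of twisted n-gons.
   They are indexed by 'Z_(n.*2), so that index arithmetic is modulo 2n; the
   index 0 stands for 2n, and parity of an index is well defined. *)
Notation corner_space K n := 'rV[K]_(Zp_trunc n.*2).+2.

Section Polygons.
Variable K : fieldType.

(* Points of P^2 are given by homogeneous coordinates: nonzero row vectors, or
   more generally matrices of rank 1, up to equality of their row spaces; a line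
   is a matrix of rank 2. PGL_3 acts by multiplication on the right. *)
Definition same_point (m1 m2 : nat) (p : 'M[K]_(m1, 3)) (q : 'M[K]_(m2, 3))
  : bool := (p == q)%MS.

Definition line (p q : 'rV[K]_3) : 'M[K]_3 := (p + q)%MS.

Definition meet (l l' : 'M[K]_3) : 'M[K]_3 := (l :&: l')%MS.

(* [p1, p2, p3, p4] = c for collinear points, of affine parameters t1, ..., t4
   in the chart t |-> a + t b of the line spanned by a and b. *)
Definition cross_ratio (m1 m2 m3 m4 : nat) (p1 : 'M[K]_(m1, 3))
    (p2 : 'M[K]_(m2, 3)) (p3 : 'M[K]_(m3, 3)) (p4 : 'M[K]_(m4, 3)) (c : K)
    : Prop :=
  exists a b : 'rV[K]_3, exists t1 t2 t3 t4 : K,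
    [/\ row_free (col_mx a b),
        [/\ same_point p1 (a + t1 *: b), same_point p2 (a + t2 *: b),
            same_point p3 (a + t3 *: b) & same_point p4 (a + t4 *: b)],
        t1 != t3, t2 != t4
      & c = (t1 - t2) * (t3 - t4) / ((t1 - t3) * (t2 - t4))].

Definition noncollinear (p q r : 'rV[K]_3) : bool := row_full (p + q + r)%MS.

(* Any four consecutive vertices are in general position: with consecutive
   triples not collinear, this is what it takes for all the cross-ratios below
   to be defined. The corner invariants are then nonzero. *)
Definition generic (v : int -> 'rV[K]_3) : Prop :=
  forall i : int,
    [/\ noncollinear (v i) (v (i + 1)) (v (i + 2)),
        noncollinear (v i) (v (i + 1)) (v (i + 3)),
        noncollinear (v i) (v (i + 2)) (v (i + 3))
      & noncollinear (v (i + 1)) (v (i + 2)) (v (i + 3))].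

Definition twisted_ngon (n : nat) (v : int -> 'rV[K]_3) (M : 'M[K]_3) : Prop :=
  [/\ forall i : int, v i != 0, M \in unitmx
    & forall i : int, same_point (v (i + n%:Z)) (v i *m M)].

(* x is the vector of corner invariants of the polygon v. *)
Definition corner_invariants (n : nat) (v : int -> 'rV[K]_3)
    (x : corner_space K n) : Prop :=
  forall i : int,
    cross_ratio (v (i - 2)) (v (i - 1))
      (meet (line (v (i - 2)) (v (i - 1))) (line (v i) (v (i + 1))))
      (meet (line (v (i - 2)) (v (i - 1))) (line (v (i + 1)) (v (i + 2))))
      (x 0 (2 * i - 1)%:~R)
    /\
    cross_ratio (v (i + 2)) (v (i + 1))
      (meet (line (v (i + 2)) (v (i + 1))) (line (v i) (v (i - 1))))
      (meet (line (v (i + 2)) (v (i + 1))) (line (v (i - 1)) (v (i - 2))))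
      (x 0 (2 * i)%:~R).

(* C_n in corner coordinates; a scalar matrix is the identity of PGL_3. *)
Definition closed_ngons (n : nat) : set (corner_space K n) :=
  [set x | exists (v : int -> 'rV[K]_3) (M : 'M[K]_3),
    [/\ twisted_ngon n v M, generic v, is_scalar_mx M
      & corner_invariants v x]].

(* The index sets I and J of the factors X_i and x_j of an admissible monomial;
   the indices in I have parity b (true for odd), those in J the other one.
   Equal indices are harmless: their difference 0 is not excluded as n >= 5. *)
Definition admissible (n : nat) (b : bool) (I J : {set 'Z_(n.*2)}) : bool :=
  [&& [forall i in I, odd i == b],
      [forall j in J, odd j != b],
      [forall i in I, forall i' in I, i' - i \notin [:: 2; -2; 4; -4]],
      [forall j in J, forall j' in J, j' - j \notin [:: 2; -2]]
    & [forall i in I, forall j in J, j - i \notin [:: 1; -1; 3; -3]]].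

Definition monodromy_sum (n : nat) (b : bool) (k : nat) (x : corner_space K n)
    : K :=
  \sum_(IJ : {set 'Z_(n.*2)} * {set 'Z_(n.*2)}
        | admissible b IJ.1 IJ.2 && (#|IJ.1| + #|IJ.2| == k)%N)
    (-1) ^+ #|IJ.2|
    * (\prod_(i in IJ.1) (x 0 (i - 1) * x 0 i * x 0 (i + 1)))
    * (\prod_(j in IJ.2) x 0 j).

Definition O_ (n k : nat) : corner_space K n -> K := @monodromy_sum n false k.
Definition E_ (n k : nat) : corner_space K n -> K := @monodromy_sum n true k.
Definition O_top (n : nat) (x : corner_space K n) : K :=
  \prod_(j : 'Z_(n.*2) | odd j) x 0 j.
Definition E_top (n : nat) (x : corner_space K n) : K :=
  \prod_(j : 'Z_(n.*2) | ~~ odd j) x 0 j.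

Inductive monodromy_invariant (n : nat) : (corner_space K n -> K) -> Prop :=
| MonodromyO k : (1 <= k <= n./2)%N -> monodromy_invariant (@O_ n k)
| MonodromyE k : (1 <= k <= n./2)%N -> monodromy_invariant (@E_ n k)
| MonodromyOtop : monodromy_invariant (@O_top n)
| MonodromyEtop : monodromy_invariant (@E_top n).

End Polygons.

Section Poisson.
Variables (K : numFieldType) (n : nat).
Local Notation space := (corner_space K n).
Implicit Types (f g : space -> K) (x : space).

(* {x_i, x_j} *)
Definition coord_bracket x (i j : 'Z_(n.*2)) : K :=
  if j == i + 2 then (-1) ^+ i * x 0 i * x 0 j
  else if i == j + 2 then - ((-1) ^+ j * x 0 j * x 0 i)
  else 0.

Definition poisson f g : space -> K := fun x =>
  \sum_i \sum_j
    'D_(delta_mx 0 i) f x * 'D_(delta_mx 0 j) g x * coord_bracket x i j.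

(* The field X_f of components {f, x_j}, hence X_f(g) = {f, g} for every g. *)
Definition hamiltonian_field f : space -> space := fun x =>
  \row_j poisson f (fun y : space => y 0 j) x.

Lemma hamiltonian_fieldP f g x :
  differentiable g x -> 'D_(hamiltonian_field f x) g x = poisson f g x.
Proof.
set w := hamiltonian_field f x => dg.
have coordE (i j : 'Z_(n.*2)) :
    'D_(delta_mx 0 i) (fun y : space => y 0 j) x = (i == j)%:R.
  have c_lin : linear (fun y : space => y 0 j : K).
    by move=> a y z; rewrite !mxE.
  pose cM := GRing.isLinear.Build _ _ _ _ _ c_lin.
  pose c : {linear space -> K} := HB.pack (fun y : space => y 0 j : K) cM.
  have c_cont : continuous c by exact: coord_continuous.
  rewrite (_ : (fun y : space => y 0 j) = c) // deriveE; last first.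
    exact/linear_differentiable.
  by rewrite diff_lin //= mxE eqxx eq_sym.
have wE j : w 0 j = \sum_i 'D_(delta_mx 0 i) f x * coord_bracket x i j.
  rewrite mxE; apply: eq_bigr => i _; rewrite (bigD1 j) //= big1.
    by rewrite coordE eqxx mulr1 addr0.
  by move=> k /negPf kj; rewrite coordE kj mulr0 mul0r.
rewrite deriveE // [w]row_sum_delta linear_sum /poisson exchange_big /=.
apply: eq_bigr => j _; rewrite linearZ /= wE -deriveE // scaler_suml.
by apply: eq_bigr => i _; rewrite /GRing.scale /= mulrAC.
Qed.

End Poisson.

Section Submanifolds.
Variables (K : numFieldType) (m : nat).
Implicit Types (S : set 'rV[K]_m) (p : 'rV[K]_m).

(* Near p, S is a submanifold of codimension c: the zero set of a C^1 (over the
   complex numbers, holomorphic) submersion to K^c. *)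
Definition smooth_point (c : nat) S p : Prop :=
  S p /\ exists g : 'rV[K]_m -> 'rV[K]_c,
    [/\ \forall x \near p, differentiable g x,
        \forall x \near p, {for x, continuous (fun y => 'J g y)},
        \rank ('J g p) = c
      & \forall x \near p, S x <-> g x = 0].

(* Velocity vectors at p of differentiable curves in S through p. *)
Definition tangent_space S p : set 'rV[K]_m :=
  [set w | exists gamma : K -> 'rV[K]_m,
    [/\ gamma 0 = p,
        \forall t \near (0 : K), S (gamma t),
        \forall t \near (0 : K), derivable gamma t 1
      & is_derive (0 : K) 1 gamma w]].

End Submanifolds.

Definition hamiltonian_fields_tangent (K : numFieldType) (n : nat) : Prop :=
  forall F : corner_space K n -> K, monodromy_invariant F ->
  forall p : corner_space K n, smooth_point 8 (@closed_ngons K n) p ->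
    tangent_space (@closed_ngons K n) p (hamiltonian_field F p).

(* Main.v *)
Require Import Defs.
From mathcomp Require Import all_classical all_reals all_analysis.
From mathcomp Require Import all_boot all_order all_algebra.
From mathcomp Require Import complex.
From mathcomp Require Import ring lra zify.

(** Lift a closed polygon to vectors v_i that are n-periodic in i. Genericity
gives a recurrence v_{i+2} = A_i v_{i+1} + B_i v_i + C_i v_{i-1} with nonzero
periodic coefficients, and the corner invariants are its invariants under
rescaling of the vectors:
  x_{2i} = - B_i / (A_i A_{i-1}),  x_{2i-1} = C_i A_{i-1} / (B_i B_{i-1}).
After the rescaling that makes every A_i equal to 1, the recurrence reads
  V_{i+2} = V_{i+1} + s_i V_i + u_i V_{i-1},  s_i = - x_{2i},  u_i = X_{2i-1}.

This explains the combinatorics of E_k. Cover the n cyclic slots by dimers (on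
the slots i and i+1, of weight s_i), by trimers (on i-1, i and i+1, of weight
u_i) and by monomers (of weight 1). A set of dimers and trimers is admissible
exactly when no two of them overlap, so E_k is the sum of the weights of the
packings with k dimers and trimers [monodromy_sum_packing], and the sum of the
t^k E_k is the trace of the monodromy of the recurrence in which s and u are
multiplied by a spectral parameter t.

In these terms the logarithmic derivatives of s_i and u_i along the Hamiltonian
field of E_k only involve the packings of size k with a monomer, or with a
trimer, at a prescribed slot near i [hamiltonian_monodromy_sum]. The key point
is that this variation of the recurrence comes from a motion of the vertices:
  V_i' = R_i V_{i+1} + u_i P_i V_{i-1} + g_i V_i,
where R_i and P_i sum the packings with fewer than k tiles that avoid the slot
i, respectively the slots i and i+1. The formula is found by the usual dressing
argument: if psi and phi solve the recurrence at t and its adjoint, and W is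
their bilinear concomitant, then psi_i W(phi, V)_i / (1 - t) deforms the
solution V at the parameter 1, up to local terms; when products of psi and phi
are replaced by entries of the monodromy at t, which are sums of packings of a
gap, every coefficient of the expansion in t is a finite sum, whence the
truncation to fewer than k tiles. Once found, the formula is checked by hand: it amounts to
three scalar identities [flow_identities] that follow from the expansions of
sums of packings along one slot [gap_sum_left, gap_sum_right,
gap_sum_circular].

The velocities V_i' are as periodic as the polygon, so v + t V' is a closed
polygon for every t, and its corner invariants form a differentiable curve of
C_n with velocity the Hamiltonian field [polygon_curve_tangent,
tangent_monodromy_sum]. Reversing the orientation of polygons preserves C_n and
the Poisson bracket and exchanges O_k with E_k, which settles O_k. Finally O_n
and E_n are Casimir functions: their fields vanish
[hamiltonian_parity_product]. The argument is uniform in the ground field. *)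

Set Implicit Arguments.
Unset Strict Implicit.
Unset Printing Implicit Defensive.

Import Order.TTheory GRing.Theory Num.Theory.
Import numFieldNormedType.Exports.

Local Open Scope ring_scope.

(** * Packings of a conflict relation *)

Section Packings.
Variables (T : finType) (K : comNzRingType) (conf : rel T).
Hypotheses (conf_refl : reflexive conf) (conf_sym : symmetric conf).
Implicit Types (w : T -> K) (A S : {set T}) (m : T).

Definition packing A : bool :=
  [forall a in A, forall b in A, (a != b) ==> ~~ conf a b].

(** The bound on the size is strict, so that k = 0 gives the empty sum and the
expansions below hold for every k. *)
Definition packing_sum w k S : K :=
  \sum_(A : {set T} | [&& packing A, A \subset S & (#|A| < k)%N])
    \prod_(a in A) w a.

Definition neighbours m : {set T} := [set a | conf m a].

Lemma packingP A :
  reflect {in A &, forall a b, a != b -> ~~ conf a b} (packing A).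
Proof.
apply: (iffP 'forall_in_'forall_in_implyP) => h a.
  by move=> b aA bA; apply: h.
by move=> aA b bA; apply: h.
Qed.

Lemma eq_packing_sum w w' k S :
  {in S, w =1 w'} -> packing_sum w k S = packing_sum w' k S.
Proof.
move=> ww'; apply: eq_bigr => A /and3P[_ /fintype.subsetP AS _].
by apply: eq_bigr => a /AS/ww'.
Qed.

Lemma packing_setU1 m A : m \notin A ->
  packing (m |: A) = packing A && [disjoint A & neighbours m].
Proof.
move=> mA; apply/packingP/andP => [h|[/packingP h d] a b].
  split.
    by apply/packingP => a b aA bA; apply: h; rewrite inE ?aA ?bA orbT.
  rewrite disjoint_subset; apply/fintype.subsetP => a aA; rewrite !inE.
  apply: h; rewrite ?inE ?eqxx ?aA ?orbT //.
  by apply: contraNneq mA => ->.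
move: d; rewrite disjoint_subset => /fintype.subsetP d.
rewrite !inE => /predU1P[->|aA] /predU1P[->|bA]; rewrite ?eqxx //.
- by move: (d b bA); rewrite !inE.
- by move: (d a aA); rewrite !inE conf_sym.
- exact: h.
Qed.

(** A packing either avoids m, or consists of m and of a packing of the
non-neighbours of m. *)
Lemma packing_sum_vertex w k S m : m \in S ->
  packing_sum w k.+1 S
  = packing_sum w k.+1 (S :\ m) + w m * packing_sum w k (S :\: neighbours m).
Proof.
move=> mS; rewrite /packing_sum (bigID (fun A : {set T} => m \in A)) /= addrC.
congr (_ + _).
  apply: eq_bigl => A; rewrite subsetD1.
  by case: (m \in A); rewrite ?andbF ?andbT.
rewrite (reindex_onto (fun A => m |: A) (fun A => A :\ m)) /=; last first.
  by move=> A /andP[_ mA]; rewrite setD1K.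
rewrite mulr_sumr; apply: eq_big => [A|A].
  have [mA|mA] := boolP (m \in A).
    have -> : (m |: A) :\ m == A = false.
      by apply/eqP => /setP/(_ m); rewrite !inE eqxx mA.
    rewrite andbF; apply/esym/negbTE; apply/negP => /and3P[_ + _].
    by move=> /fintype.subsetP/(_ _ mA); rewrite !inE conf_refl.
  rewrite setU1K // eqxx packing_setU1 // cardsU1 mA setU11 !andbT.
  rewrite subUset sub1set mS /= subsetD add1n ltnS.
  by case: (packing A) => //=; rewrite andbCA andbA.
move=> /andP[/andP[_ mA] /eqP eA].
by rewrite big_setU1 //= -eA !inE eqxx.
Qed.

(** A packing meets a clique in at most one point. Since the clique is contained
in the neighbourhood of each of its points, the terms of the sum do not depend
on the order in which the points are removed. *)
Lemma packing_sum_clique w k S (s : seq T) :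
  uniq s -> {in s &, forall a b, conf a b} -> {subset s <= S} ->
  packing_sum w k.+1 S
  = packing_sum w k.+1 (S :\: [set a in s])
    + \sum_(m <- s) w m * packing_sum w k (S :\: neighbours m).
Proof.
elim: s => [|m s IH] /= => [_ _ _|/andP[ms us] cl sS].
  rewrite big_nil addr0; congr packing_sum.
  by apply/setP => a; rewrite !inE.
rewrite {}IH //; first last.
- by move=> a sa; apply: sS; rewrite inE sa orbT.
- by move=> a b sa sb; apply: cl; rewrite inE ?sa ?sb orbT.
rewrite (@packing_sum_vertex _ _ _ m); last first.
  by rewrite !inE (negPf ms) sS // inE eqxx.
rewrite big_cons addrA; congr (_ + _ * _ + _).
  congr packing_sum; apply/setP => a; rewrite !inE.
  by case: (a == m).
congr packing_sum; apply/setP => a; rewrite !inE.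
case: (boolP (a \in s)) => //= sa; rewrite (_ : conf m a) //.
by apply: cl; rewrite inE ?eqxx // sa orbT.
Qed.

Lemma packing_sum_edge w k S a b : a != b -> conf a b -> a \in S -> b \in S ->
  packing_sum w k.+1 S
  = packing_sum w k.+1 (S :\: [set a; b])
    + w a * packing_sum w k (S :\: neighbours a)
    + w b * packing_sum w k (S :\: neighbours b).
Proof.
move=> nab cab aS bS; rewrite (@packing_sum_clique w k S [:: a; b]).
- rewrite !big_cons big_nil addr0 addrA; congr (packing_sum _ _ _ + _ + _).
  by apply/setP => c; rewrite !inE.
- by rewrite /= inE nab.
- by move=> c d; rewrite !inE => /orP[]/eqP-> /orP[]/eqP->; rewrite // conf_sym.
- by move=> c; rewrite !inE => /orP[]/eqP->.
Qed.

End Packings.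

(** * Corner indices modulo 2n *)

Section Indices.
Variables (n : nat) (hn : (5 <= n)%N).
Local Notation Z2n := 'Z_(n.*2).
Implicit Types (a b m : Z2n) (i j : int).

Lemma modulusE : (Zp_trunc n.*2).+2 = n.*2.
Proof. by rewrite Zp_cast // -addnn; lia. Qed.

Lemma odd_indexD a b : odd (a + b)%R = odd a (+) odd b.
Proof.
by rewrite /= odd_mod ?oddD // modulusE odd_double.
Qed.

Lemma odd_index1 : odd (1%R : Z2n).
Proof. by []. Qed.

Lemma odd_indexN a : odd (- a)%R = odd a.
Proof. by have := odd_indexD a (- a); rewrite subrr /=; case: odd; case: odd. Qed.

Lemma odd_int j : odd (j%:~R%R : Z2n) = odd `|j|%N.
Proof.
have odd_nat k : odd (k%:R%R : Z2n) = odd k.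
  by elim: k => // k IH; rewrite -natr1 odd_indexD IH odd_index1 /= addbT.
by case: j => k; rewrite ?NegzE ?mulrNz ?odd_indexN ?abszN -pmulrn odd_nat.
Qed.

(** As 2n >= 10, integers at distance at most 9 are told apart; all the index
computations below stay within that range. *)
Lemma index_int_eq i j : (`|i - j| < n.*2)%N -> (i%:~R == j%:~R :> Z2n) = (i == j).
Proof.
move=> ij; rewrite -subr_eq0 -intrB -[RHS]subr_eq0; move: ij.
have nat_eq0 k : (k < n.*2)%N -> (k%:R == 0 :> Z2n) = (k == 0)%N.
  by move=> kn; rewrite -val_eqE /= val_Zp_nat // ?modn_small // -addnn; lia.
case: (i - j) => k; rewrite ?NegzE ?abszN ?mulrNz ?oppr_eq0 => kn;
  rewrite -pmulrn nat_eq0 //.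
Qed.

Lemma index_period i : (2 * (i + n%:Z))%:~R = (2 * i)%:~R :> Z2n.
Proof.
rewrite mulrDr intrD (_ : (2 * n%:Z)%:~R = 0 :> Z2n) ?addr0 //.
rewrite (_ : 2 * n%:Z = n.*2%:Z); last by rewrite -addnn; lia.
by rewrite -pmulrn pchar_Zp // -addnn; lia.
Qed.

Lemma index_even m : ~~ odd m -> (2 * (m./2)%:Z)%:~R = m.
Proof.
move=> em; have mE : (m./2 * 2)%:R = m by rewrite muln2 even_halfK // natr_Zp.
by rewrite -[RHS]mE natrM mulrC intrM.
Qed.

Lemma index_odd m : odd m -> (2 * (uphalf m)%:Z - 1)%:~R = m.
Proof.
move=> om; have mE : (uphalf m * 2)%:R = m + 1.
  by rewrite muln2 uphalfE even_halfK /= ?om // -natr1 natr_Zp.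
by rewrite -[RHS](addrK 1) -mE natrM mulrC intrB intrM.
Qed.
End Indices.

(** * Dimers and trimers on a cycle of n slots *)

Section Tiles.
Variables (n : nat) (hn : (5 <= n)%N).
Local Notation Z2n := 'Z_(n.*2).
Implicit Types (a b m d : Z2n) (i j : int).

(** The even index 2i stands for the dimer that covers the slots i and i+1, the
odd index 2i-1 for the trimer that covers i-1, i and i+1. This is the conflict
relation of the admissible monomials of E_k; the lemmas overlap_dimer and
overlap_trimer show that it is the overlap of tiles. *)
Definition overlap : rel Z2n := fun a b =>
  b - a \in if odd a == odd b then
              if odd a then [:: 0; 2; -2; 4; -4] else [:: 0; 2; -2]
            else [:: 1; -1; 3; -3].

(** The tile m covers the slot j: the dimers at j-1 and j and the trimers
centred at j-1, j and j+1 have the five consecutive indices 2j-3, ..., 2j+1. *)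
Definition covers m j : bool := m - (2 * j)%:~R \in [:: -3; -2; -1; 0; 1].

Definition gap j (l : nat) : {set Z2n} :=
  [set m | all (fun e : nat => ~~ covers m (j + e%:Z)) (iota 0 l)].

Lemma overlap_refl : reflexive overlap.
Proof. by move=> a; rewrite /overlap subrr eqxx; case: (odd a). Qed.

Lemma overlap_sym : symmetric overlap.
Proof.
move=> a b; rewrite /overlap -[b - a]opprB [odd b == _]eq_sym.
case: eqP => [->|_]; first case: (odd b).
all: by rewrite !inE !eqr_oppLR ?opprK ?oppr0; do ?case: (_ == _).
Qed.

(** In this range for z - 2j, no value is congruent modulo 2n to an element of
[-3, 1] other than itself. *)
Lemma covers_int (z j : int) : -8 <= z - 2 * j <= 6 ->
  covers z%:~R j = (-3 <= z - 2 * j <= 1).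
Proof.
move=> zj; rewrite /covers -intrB; set d := z - 2 * j in zj *.
rewrite -[-3]/((-3)%:~R) -[-2]/((-2)%:~R) -[-1]/((-1)%:~R).
rewrite -[0 : Z2n]/(0%:~R) -[1 : Z2n]/(1%:~R).
rewrite !inE !index_int_eq //; lia.
Qed.
(** Lists of differences are kept as lists of integers, so that translating them
is a computation with concrete integers. *)
Definition shifts (l : seq int) : seq Z2n := [seq c%:~R | c <- l].

Lemma shiftsD d (c : int) l :
  (d - c%:~R \in shifts l) = (d \in shifts [seq z + c | z <- l]).
Proof.
rewrite /shifts; elim: l => //= z l IH; rewrite !inE IH.
by rewrite subr_eq intrD.
Qed.

Lemma odd_sub_int d (c : int) : odd (d - c%:~R)%R = odd d (+) odd `|c|%N.
Proof. by rewrite odd_indexD // (odd_indexN hn) odd_int. Qed.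

Lemma parity_neq d (c : int) : odd d != odd `|c|%N -> (d == c%:~R) = false.
Proof. by apply: contraNF => /eqP ->; rewrite odd_int. Qed.

Lemma coversE m j (c : int) :
  covers m j = (m - (2 * j + c)%:~R
                  \in shifts [seq z - c | z <- [:: -3; -2; -1; 0; 1]]).
Proof. by rewrite -shiftsD intrD mulrNz opprK opprD addrA subrK. Qed.

(** Both slots together are covered by the indices at distance at most 3 from
2i; among them, parity selects the distances listed in the definition. *)
Lemma overlap_dimer i m :
  overlap (2 * i)%:~R m = covers m i || covers m (i + 1).
Proof.
rewrite (coversE m i 0) (coversE m (i + 1) (-2)) mulrDr addrK addr0.
have om := odd_sub_int m (2 * i).
rewrite abszM oddM addbF in om.
rewrite /overlap (odd_int hn) abszM oddM -om; set d := m - _.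
have p c : odd d != odd `|c|%N -> (d == c%:~R) = false := @parity_neq d c.
rewrite [LHS](_ : _ = (d \in shifts (if odd d then [:: 1; -1; 3; -3]
                                     else [:: 0; 2; -2]))); last first.
  by rewrite -?[odd _]/(odd d); case: (odd d).
rewrite [X in _ = X || _](_ : _ = (d \in shifts [:: -3; -2; -1; 0; 1])) //.
rewrite [X in _ = _ || X](_ : _ = (d \in shifts [:: -1; 0; 1; 2; 3])) //.
case od: (odd d) p => p; rewrite !inE.
  by rewrite (p (-2)) ?(p 0) ?(p 2) //; do ?case: (_ == _).
by rewrite (p (-3)) ?(p (-1)) ?(p 1) ?(p 3) //; do ?case: (_ == _).
Qed.

Lemma overlap_trimer i m :
  overlap (2 * i - 1)%:~R m
  = [|| covers m (i - 1), covers m i | covers m (i + 1)].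
Proof.
have e1 : 2 * (i - 1) + 1 = 2 * i - 1 by lia.
have e3 : 2 * (i + 1) - 3 = 2 * i - 1 by lia.
rewrite (coversE m (i - 1) 1) (coversE m i (-1)) (coversE m (i + 1) (-3)) e1 e3.
have om := odd_sub_int m (2 * i - 1).
have o1 : odd `|(2 * i - 1)%R|%N by lia.
rewrite o1 addbT in om.
rewrite /overlap (odd_int hn) o1 -[odd m]negbK -om; set d := m - _.
have p c : odd d != odd `|c|%N -> (d == c%:~R) = false := @parity_neq d c.
rewrite [LHS](_ : _ = (d \in shifts (if odd d then [:: 1; -1; 3; -3]
                                     else [:: 0; 2; -2; 4; -4]))); last first.
  by rewrite -?[odd _]/(odd d); case: (odd d).
rewrite [X in _ = [|| X, _ | _]](_ : _ = (d \in shifts [:: -4; -3; -2; -1; 0])) //.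
rewrite [X in _ = [|| _, X | _]](_ : _ = (d \in shifts [:: -2; -1; 0; 1; 2])) //.
rewrite [X in _ = [|| _, _ | X]](_ : _ = (d \in shifts [:: 0; 1; 2; 3; 4])) //.
case od: (odd d) p => p; rewrite !inE.
  by rewrite (p (-4)) ?(p (-2)) ?(p 0) ?(p 2) ?(p 4) //; do ?case: (_ == _).
by rewrite (p (-3)) ?(p (-1)) ?(p 1) ?(p 3) //; do ?case: (_ == _).
Qed.
End Tiles.

(** * Packings of a gap *)

Section Gaps.
Variables (n : nat) (hn : (5 <= n)%N) (K : comNzRingType) (w : 'Z_(n.*2) -> K).
Local Notation Z2n := 'Z_(n.*2).
Implicit Types (a b m d : Z2n) (i j : int) (k l : nat).

Definition gap_sum k j l : K := packing_sum (@overlap n) w k (gap n j l).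
Local Notation s i := (w (2 * i)%:~R).
Local Notation u i := (w (2 * i - 1)%:~R).

Lemma gapP j l m :
  (m \in gap n j l) = all (fun e : nat => ~~ covers m (j + e%:Z)) (iota 0 l).
Proof. by rewrite inE. Qed.

Lemma gapSl j l m :
  (m \in gap n j l.+1) = ~~ covers m j && (m \in gap n (j + 1) l).
Proof.
rewrite !gapP /= addr0 -[1%N]/(1 + 0)%N iotaDl all_map; congr (_ && _).
by apply: eq_all => e /=; rewrite PoszD addrA.
Qed.

Lemma gapSr j l m :
  (m \in gap n j l.+1) = (m \in gap n j l) && ~~ covers m (j + l%:Z).
Proof. by rewrite !gapP -addn1 iotaD all_cat /= andbT. Qed.

Lemma gap0 j : gap n j 0 = setT.
Proof. by apply/setP => m; rewrite !inE. Qed.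

Lemma covers_cases m j : covers m j ->
  exists2 c : int, m = (2 * j + c)%:~R & -3 <= c <= 1.
Proof.
rewrite /covers !inE -[-3]/((-3)%:~R) -[-2]/((-2)%:~R) -[-1]/((-1)%:~R).
rewrite -[0 : Z2n]/(0%:~R) -[1 : Z2n]/(1%:~R) => cm.
have mE c : m - (2 * j)%:~R == c%:~R -> m = (2 * j + c)%:~R.
  by move=> /eqP h; rewrite intrD -h addrC subrK.
by case/or4P: cm => [/mE|/mE|/mE|/orP[/mE|/mE]] ->; eexists; try reflexivity.
Qed.

Lemma covers_left m j : covers m j -> ~~ covers m (j + 1) ->
  m \in [:: (2 * (j - 1))%:~R; (2 * (j - 1) - 1)%:~R].
Proof.
move=> /covers_cases[c -> c31]; rewrite covers_int //; last by lia.
move=> c1; have : c = -3 \/ c = -2 by lia.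
rewrite !inE; case=> ->; apply/orP; [right|left]; apply/eqP; congr _%:~R; lia.
Qed.

Lemma covers_right m j : covers m j -> ~~ covers m (j - 1) ->
  m \in [:: (2 * j)%:~R; (2 * (j + 1) - 1)%:~R].
Proof.
move=> /covers_cases[c -> c31]; rewrite covers_int //; last by lia.
move=> c1; have : c = 0 \/ c = 1 by lia.
rewrite !inE; case=> ->; apply/orP; [left|right]; apply/eqP; congr _%:~R; lia.
Qed.

Lemma mem_gap_int (z j : int) l :
  -8 <= z - 2 * j <= 6 -> -8 <= z - 2 * (j + l%:Z - 1) <= 6 ->
  (z%:~R \in gap n j l)
  = ~~ has (fun e : nat => -3 <= z - 2 * (j + e%:Z) <= 1) (iota 0 l).
Proof.
move=> h1 h2; rewrite gapP -all_predC; apply: eq_in_all => e.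
rewrite mem_iota => el /=.
by rewrite covers_int //; lia.
Qed.

(** Expansion along the slot j to the left of a gap: it is a monomer, or the right
end of a dimer or of a trimer. With five slots at least, a gap of at most two
slots leaves room for both tiles. *)
Lemma gap_sum_left k j l : (0 < l <= 2)%N ->
  gap_sum k.+1 (j + 1) l = gap_sum k.+1 j l.+1
    + s (j - 1) * gap_sum k (j - 1) l.+2 + u (j - 1) * gap_sum k (j - 2) l.+3.
Proof.
move=> l12; rewrite /gap_sum.
have l01 : l = 1 \/ l = 2 by lia.
rewrite (@packing_sum_edge _ _ _ (@overlap_refl n) (@overlap_sym n) w k _
  (2 * (j - 1))%:~R (2 * (j - 1) - 1)%:~R).
- congr (_ + _ * _ + _ * _); congr packing_sum.
  + apply/setP => m; rewrite in_setD gapSl.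
    have [mc|mc] /= := boolP (m \in gap n (j + 1) l); rewrite ?andbF // !andbT.
    have mj : ~~ covers m (j + 1).
      by case: l l12 mc l01 => // l _; rewrite gapSl => /andP[].
    congr (~~ _); apply/idP/idP; last first.
      by move=> h; have := covers_left h mj; rewrite !inE.
    by rewrite !inE => /orP[] /eqP ->; rewrite covers_int; lia.
  + apply/setP => m; rewrite in_setD inE overlap_dimer // !gapSl subrK.
    by rewrite negb_or -andbA.
  + apply/setP => m; rewrite in_setD inE overlap_trimer // !gapSl.
    rewrite (_ : j - 2 = j - 1 - 1) ?subrK; last by lia.
    by rewrite !negb_or -!andbA.
- rewrite index_int_eq //; lia.
- by rewrite overlap_dimer // covers_int; lia.
- by rewrite mem_gap_int; case: l01 => ll; rewrite ?ll /=; lia.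
- by rewrite mem_gap_int; case: l01 => ll; rewrite ?ll /=; lia.
Qed.

Lemma gap_sum_right k j l : (0 < l <= 2)%N ->
  gap_sum k.+1 j l = gap_sum k.+1 j l.+1
    + s (j + l%:Z) * gap_sum k j l.+2 + u (j + l%:Z + 1) * gap_sum k j l.+3.
Proof.
move=> l12; rewrite /gap_sum.
have l01 : l = 1 \/ l = 2 by lia.
rewrite (@packing_sum_edge _ _ _ (@overlap_refl n) (@overlap_sym n) w k _
  (2 * (j + l%:Z))%:~R (2 * (j + l%:Z + 1) - 1)%:~R).
- congr (_ + _ * _ + _ * _); congr packing_sum.
  + apply/setP => m; rewrite in_setD gapSr andbC.
    have [mc|mc] //= := boolP (m \in gap n j l).
    have mj : ~~ covers m (j + l%:Z - 1).
      case: l l12 mc l01 => // l _; rewrite gapSr => /andP[_].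
      by rewrite -addn1 PoszD addrA addrK.
    congr (~~ _); apply/idP/idP; last first.
      by move=> h; have := covers_right h mj; rewrite !inE.
    by rewrite !inE => /orP[] /eqP ->; rewrite covers_int; lia.
  + apply/setP => m; rewrite in_setD inE overlap_dimer // !gapSr andbC.
    by rewrite negb_or -[l.+1]addn1 PoszD addrA andbA.
  + apply/setP => m; rewrite in_setD inE overlap_trimer // !gapSr andbC addrK.
    have -> : j + l.+1%:Z = j + l%:Z + 1 by lia.
    have -> : j + l.+2%:Z = j + l%:Z + 1 + 1 by lia.
    by rewrite !negb_or !andbA.
- rewrite index_int_eq //; lia.
- by rewrite overlap_dimer // covers_int; lia.
- by rewrite mem_gap_int; case: l01 => ll; rewrite ?ll /=; lia.
- by rewrite mem_gap_int; case: l01 => ll; rewrite ?ll /=; lia.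
Qed.

Definition tiles_at j : seq Z2n :=
  [:: (2 * j)%:~R; (2 * (j - 1))%:~R; (2 * (j - 1) - 1)%:~R; (2 * j - 1)%:~R;
      (2 * (j + 1) - 1)%:~R].

Lemma mem_tiles_at m j : (m \in tiles_at j) = covers m j.
Proof.
apply/idP/idP.
  by rewrite !inE => /or4P[| | |/orP[]] /eqP ->; rewrite covers_int; lia.
move=> /covers_cases[c -> c31].
have : c = -3 \/ c = -2 \/ c = -1 \/ c = 0 \/ c = 1 by lia.
rewrite !inE.
by case=> [->|[->|[->|[->|->]]]]; apply/or4P;
  [apply: Or43 | apply: Or42 | apply: Or44; apply/orP;left | apply: Or41
    | apply: Or44; apply/orP; right]; apply/eqP; congr _%:~R; lia.
Qed.

Lemma covers_overlap a b j : covers a j -> covers b j -> overlap a b.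
Proof.
rewrite -mem_tiles_at => + bj.
by rewrite /tiles_at !inE => /or4P[| | |/orP[]] /eqP ->;
  rewrite ?overlap_dimer ?overlap_trimer // ?subrK ?addrK bj ?orbT.
Qed.

Lemma uniq_tiles_at j : uniq (tiles_at j).
Proof. by rewrite /= !inE !index_int_eq //; lia. Qed.

(** Expansion of the sum of all packings along the slot j: it is a monomer or is
covered by one of five tiles. As the left-hand side does not depend on j, this
relates the packings around neighbouring slots. *)
Lemma gap_sum_circular k j :
  packing_sum (@overlap n) w k.+1 setT
  = gap_sum k.+1 j 1
    + s j * gap_sum k j 2 + s (j - 1) * gap_sum k (j - 1) 2
    + u (j - 1) * gap_sum k (j - 2) 3 + u j * gap_sum k (j - 1) 3
    + u (j + 1) * gap_sum k j 3.
Proof.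
rewrite /gap_sum.
rewrite (@packing_sum_clique _ _ _ (@overlap_refl n) (@overlap_sym n) w k _
  (tiles_at j)).
- rewrite !big_cons big_nil addr0 !addrA.
  congr (_ + _ * _ + _ * _ + _ * _ + _ * _ + _ * _); congr packing_sum;
    apply/setP => m; rewrite in_setD in_setT inE.
  + by rewrite mem_tiles_at gapSl gap0 in_setT.
  + by rewrite overlap_dimer // !gapSl gap0 in_setT !andbT negb_or.
  + by rewrite overlap_dimer // !gapSl gap0 in_setT !andbT negb_or.
  + rewrite overlap_trimer // !gapSl gap0 in_setT !andbT !negb_or.
    by rewrite (_ : j - 2 = j - 1 - 1) ?subrK; last by lia.
  + by rewrite overlap_trimer // !gapSl gap0 in_setT !andbT !negb_or subrK.
  + by rewrite overlap_trimer // !gapSl gap0 in_setT !andbT !negb_or addrK.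
- exact: uniq_tiles_at.
- by move=> a b; rewrite !mem_tiles_at; exact: covers_overlap.
- by move=> a _; rewrite in_setT.
Qed.

End Gaps.

(** * The motion of the vertices *)

Section Flow.
Variables (n : nat) (hn : (5 <= n)%N) (K : fieldType) (w : 'Z_(n.*2) -> K) (k : nat).
Local Notation Z2n := 'Z_(n.*2).
Implicit Types (i j : int).
Local Notation s i := (w (2 * i)%:~R).
Local Notation u i := (w (2 * i - 1)%:~R).
Local Notation Y := (gap_sum w).

(** Packings of exactly k+1 tiles for which i is a monomer, respectively the
centre of a trimer. *)
Definition monomer_sum i : K := Y k.+2 i 1 - Y k.+1 i 1.
Definition trimer_sum i : K := u i * (Y k.+1 (i - 1) 3 - Y k (i - 1) 3).
(** The logarithmic derivatives of s_i and u_i along the flow of E_{k+1}, in the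
form in which they are produced by the motion of the vertices. *)
Definition dimer_rate i : K :=
  monomer_sum (i + 1) - monomer_sum i + trimer_sum i - trimer_sum (i + 1).
Definition trimer_rate i : K := monomer_sum (i + 1) - monomer_sum (i - 1).
(** The coefficient of V_i in its own velocity. It does not move the points of
the plane; this choice keeps the coefficient A_i of the recurrence constant. *)
Definition drift i : K :=
  monomer_sum i + s i * Y k.+1 i 2 + u (i + 1) * Y k.+1 i 3.

(** The coefficients of V_{i+1}, V_i and V_{i-1} in the linearization at V' of
V_{i+2} = V_{i+1} + s_i V_i + u_i V_{i-1}, the variations of s_i and u_i being
s_i dimer_rate i and u_i trimer_rate i; the last one is divided by u_i. The
number c collects the multiples of V_{i+2} in V_{i+2}' - V_{i+1}'. Comparing the
circular expansions around i+1 and i+2 expresses it by packings around i and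
i+1, and the remaining terms match after one expansion on each side of the
gaps. *)
Lemma flow_identities i :
  let c := Y k.+1 (i + 2) 1 + drift (i + 2) - Y k.+1 (i + 1) 1 in
  [/\ c + s (i + 1) * Y k.+1 (i + 2) 1 + u (i + 2) * Y k.+1 (i + 2) 2
        - drift (i + 1) - s i * Y k.+1 i 1 - u i * Y k.+1 (i - 1) 2 = 0,
      s i * c + u (i + 1) * Y k.+1 (i + 2) 1 - u (i + 1) * Y k.+1 (i + 1) 2
        - s i * drift i - u i * Y k.+1 (i - 1) 1 + u i * Y k.+1 (i - 1) 2
      = s i * dimer_rate i
    & c - s i * Y k.+1 i 2 + s (i - 1) * Y k.+1 (i - 1) 2 - drift (i - 1)
      = trimer_rate i].
Proof.
have e0 j : j - 1 + 1 = j := subrK 1 j.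
have e1 j : j + 1 - 1 = j := addrK 1 j.
have e2 j : j + 2 - 1 = j + 1 by lia.
have e3 j : j + 1 + 1 = j + 2 by lia.
have e4 j : j + 1 - 2 = j - 1 by lia.
have e5 j : j + 2 - 2 = j by lia.
have e6 : i + 2 + 1 = i + 1 + 2 by lia.
have C2 := gap_sum_circular hn w k.+1 (i + 2).
have C1 := gap_sum_circular hn w k.+1 (i + 1).
have L1 := @gap_sum_left n hn _ w k (i + 1) 1 isT.
have L2 := @gap_sum_left n hn _ w k (i + 1) 2 isT.
have R0 := @gap_sum_right n hn _ w k i 1 isT.
have R1 := @gap_sum_right n hn _ w k (i - 1) 1 isT.
have R2 := @gap_sum_right n hn _ w k (i - 1) 2 isT.
have e7 : i - 1 + 2%:Z = i + 1 by lia.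
rewrite ?(e0, e1, e2, e3, e4, e5, e6, e7) in C2 C1 L1 L2 R0 R1 R2.
rewrite /= /drift /dimer_rate /trimer_rate /monomer_sum /trimer_sum.
rewrite ?(e0, e1, e2, e3, e4, e5, e6, e7).
have {C1 C2}E : Y k.+2 (i + 2) 1 = Y k.+2 (i + 1) 1 + s i * Y k.+1 i 2
    + u i * Y k.+1 (i - 1) 3 - s (i + 2) * Y k.+1 (i + 2) 2
    - u (i + 1 + 2) * Y k.+1 (i + 2) 3.
  apply/eqP; rewrite -subr_eq0; apply/eqP.
  rewrite -[RHS](subrr (packing_sum (@overlap n) w k.+2 setT)) {1}C2 C1; ring.
rewrite -[1%:Z]/(1 : int) in R0.
by rewrite E L1 L2 R0 R1 R2; split; ring.
Qed.

(** The flow identities make the motion compatible with the recurrence, here for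
arbitrary A_i and in one coordinate. The suffixes 3, 2, 1, 0, m, n and o stand
for the indices i+3, ..., i-3; x is the coordinate of the vertex v, a is the
coefficient A, and B_i = s_i A_i A_{i-1}, C_i = u_i A_i A_{i-1} A_{i-2}. The
letters R, A and g are the coefficients R_i, P_i and g_i of the motion. *)
Lemma deformation_coordinate (F : fieldType)
    (a1 a0 am an ao s1 s0 sm u2 u1 u0 um : F)
    (x3 x2 x1 x0 xm xn : F)
    (R2 R1 R0 Rm A2 A1 A0 Am g2 g1 g0 gm sigma upsilon : F) :
  a1 != 0 -> a0 != 0 -> am != 0 -> an != 0 ->
  x3 = a1 * x2 + s1 * a1 * a0 * x1 + u1 * a1 * a0 * am * x0 ->
  x2 = a0 * x1 + s0 * a0 * am * x0 + u0 * a0 * am * an * xm ->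
  x1 = am * x0 + sm * am * an * xm + um * am * an * ao * xn ->
  let c := R2 + g2 - R1 in
  c + s1 * R2 + u2 * A2 - g1 - s0 * R0 - u0 * Am = 0 ->
  s0 * c + u1 * R2 - u1 * A1 - s0 * g0 - u0 * Rm + u0 * Am = s0 * sigma ->
  c - s0 * A0 + sm * Am - gm = upsilon ->
  R2 / a1 * x3 + u2 * A2 * a0 * x1 + g2 * x2
  = a0 * (R1 / a0 * x2 + u1 * A1 * am * x0 + g1 * x1)
    + s0 * a0 * am * (R0 / am * x1 + u0 * A0 * an * xm + g0 * x0 + sigma * x0)
    + u0 * a0 * am * an
      * (Rm / an * x0 + um * Am * ao * xn + gm * xm + upsilon * xm).
Proof.
move=> na1 na0 nam nan -> x2E x1E c I1 I2 <-.
have -> : R2 / a1 * (a1 * x2 + s1 * a1 * a0 * x1 + u1 * a1 * a0 * am * x0)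
  = R2 * (x2 + s1 * a0 * x1 + u1 * a0 * am * x0) by field.
have -> : a0 * (R1 / a0 * x2 + u1 * A1 * am * x0 + g1 * x1)
  = R1 * x2 + a0 * (u1 * A1 * am * x0 + g1 * x1) by field.
have -> : s0 * a0 * am * (R0 / am * x1 + u0 * A0 * an * xm + g0 * x0 + sigma * x0)
  = s0 * a0 * R0 * x1 + s0 * a0 * am * (u0 * A0 * an * xm + g0 * x0)
    + s0 * sigma * a0 * am * x0 by field.
have -> : u0 * a0 * am * an * (Rm / an * x0 + um * Am * ao * xn + gm * xm
    + (c - s0 * A0 + sm * Am - gm) * xm)
  = u0 * a0 * am * (Rm * x0 + an * (c - s0 * A0 + sm * Am) * xm)
    + u0 * a0 * Am * (um * am * an * ao * xn) by field.
rewrite -I2.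
(* The recurrence one step back eliminates v_{i-2}. *)
have -> : um * am * an * ao * xn = x1 - am * x0 - sm * am * an * xm.
  by rewrite x1E; ring.
apply/eqP; rewrite -subr_eq0; apply/eqP.
transitivity (c * (x2 - (a0 * x1 + s0 * a0 * am * x0 + u0 * a0 * am * an * xm))
  + (c + s1 * R2 + u2 * A2 - g1 - s0 * R0 - u0 * Am) * a0 * x1); last first.
  by rewrite -x2E subrr I1; ring.
by rewrite /c; ring.
Qed.
End Flow.

(** * The Hamiltonian field of E_k *)

Lemma derive_affine (K : numFieldType) (V W : normedModType K) (f : V -> W)
    (a v : V) (c : W) :
  (forall h : K, f (h *: v + a) = f a + h *: c) -> 'D_v f a = c.
Proof.
move=> fE; apply: cvg_lim => //; apply: cvg_near_cst.
near=> h; rewrite /= fE addrC addKr scalerA mulVf ?scale1r //.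
by near: h; exact: nbhs_dnbhs_neq.
Unshelve. all: by end_near. Qed.

Section InvariantsAsPackings.
Variables (n : nat) (hn : (5 <= n)%N) (K : fieldType).
Local Notation Z2n := 'Z_(n.*2).
Implicit Types (m i j : Z2n) (A I J : {set Z2n}) (x : corner_space K n).

(** Putting the sign of E_k into the weight of the dimers makes every tile count
for one. *)
Definition tile_weight x m : K :=
  if odd m then x 0 (m - 1) * x 0 m * x 0 (m + 1) else - x 0 m.

Definition odds A : {set Z2n} := [set m in A | odd m].
Definition evens A : {set Z2n} := [set m in A | ~~ odd m].

Lemma small_index_neq0 (c : int) :
  (0 < `|c| < 10)%N -> (c%:~R == 0 :> Z2n) = false.
Proof. by move=> c0; rewrite -[0]/(0%:~R) index_int_eq //; lia. Qed.

Lemma admissible_packing A :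
  admissible true (odds A) (evens A) = packing (@overlap n) A.
Proof.
have m2 := @small_index_neq0 2 isT; have m4 := @small_index_neq0 4 isT.
have m2' := @small_index_neq0 (-2) isT; have m4' := @small_index_neq0 (-4) isT.
apply/and5P/packingP.
  move=> [_ _ /'forall_in_'forall_in_idP II /'forall_in_'forall_in_idP JJ].
  move=> /'forall_in_'forall_in_idP IJ a b aA bA nab.
  have nba : b - a != 0 by rewrite subr_eq0 eq_sym.
  have inI c : c \in A -> odd c -> c \in odds A by rewrite inE => -> ->.
  have inJ c : c \in A -> odd c = false -> c \in evens A by rewrite inE => -> ->.
  rewrite /overlap; case oa: (odd a); case ob: (odd b); rewrite /= ?eqxx.
  - by have := II a (inI a aA oa) b (inI b bA ob); rewrite !inE (negPf nba).
  - by have := IJ a (inI a aA oa) b (inJ b bA ob); rewrite !inE.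
  - have := IJ b (inI b bA ob) a (inJ a aA oa).
    by rewrite -[a - b]opprB !inE !eqr_oppLR !opprK; do ?case: (_ == _).
  - by have := JJ a (inJ a aA oa) b (inJ b bA ob); rewrite !inE (negPf nba).
move=> h; split.
- by apply/'forall_in_eqP => a; rewrite inE => /andP[_ ->].
- by apply/forall_inP => a; rewrite inE => /andP[_ /negPf ->].
- apply/'forall_in_'forall_in_idP => a; rewrite inE => /andP[aA oa] b.
  rewrite inE => /andP[bA ob].
  have [<-|/(h _ _ aA bA)] := eqVneq a b.
    by rewrite subrr !inE ![0 == _]eq_sym m2 m2' m4 m4'.
  by rewrite /overlap oa ob !inE; apply: contraNN => ->; rewrite orbT.
- apply/'forall_in_'forall_in_idP => a; rewrite inE => /andP[aA oa] b.
  rewrite inE => /andP[bA ob].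
  have [<-|/(h _ _ aA bA)] := eqVneq a b.
    by rewrite subrr !inE ![0 == _]eq_sym m2 m2'.
  by rewrite /overlap (negPf oa) (negPf ob) !inE; apply: contraNN => ->; rewrite orbT.
- apply/'forall_in_'forall_in_idP => a; rewrite inE => /andP[aA oa] b.
  rewrite inE => /andP[bA ob].
  have nab : a != b by apply: contraNneq ob => <-.
  by have := h _ _ aA bA nab; rewrite /overlap oa (negPf ob).
Qed.

Lemma monodromy_sum_packing k x :
  monodromy_sum true k x
  = packing_sum (@overlap n) (tile_weight x) k.+1 [set: Z2n]
    - packing_sum (@overlap n) (tile_weight x) k [set: Z2n].
Proof.
rewrite /packing_sum [X in _ = X - _](bigID (fun A : {set Z2n} => #|A| < k)%N) /=.
rewrite [X in _ = X + _ - _](eq_bigl (fun A : {set Z2n} =>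
  [&& packing (overlap (n:=n)) A, A \subset [set: Z2n] & (#|A| < k)%N])); last first.
  move=> A; rewrite -!andbA; do 2!congr (_ && _).
  by apply/andP/idP => [[]//|h]; split=> //; apply: ltnW.
rewrite addrAC subrr add0r /monodromy_sum.
rewrite (reindex_onto (fun A => (odds A, evens A))
  (fun IJ => IJ.1 :|: IJ.2)) /=; last first.
  move=> [I J] /= /andP[/and5P[/forall_inP Io' /forall_inP Je' _ _ _] _].
  have Io c : c \in I -> odd c by move/Io'/eqP.
  have Je c : c \in J -> ~~ odd c by move/Je'; case: odd.
  congr (_, _); apply/setP => m; rewrite !inE.
    have [/Io ->|mI] /= := boolP (m \in I); first by [].
    by apply/negP => /andP[/Je/negPf ->].
  have [/Je|mJ] /= := boolP (m \in J); first by rewrite orbT => /negPf; case: odd.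
  by rewrite orbF; apply/negP => /andP[/Io ->].
have oeA A : odds A :|: evens A = A.
  by apply/setP => m; rewrite !inE -andb_orr orbN andbT.
have oeD A : [disjoint odds A & evens A].
  by rewrite -setI_eq0; apply/eqP/setP => m; rewrite !inE andbACA andbN andbF.
apply: eq_big => A.
  rewrite oeA eqxx andbT admissible_packing finset.subsetT /= -cardsUI oeA.
  move: (oeD A); rewrite -setI_eq0 => /eqP ->; rewrite cards0 addn0 -andbA.
  by congr (_ && _); rewrite ltnS -leqNgt -eqn_leq.
move=> _.
transitivity (\prod_(a in [predU odds A & evens A]) tile_weight x a); last first.
  by apply: eq_bigl => m; rewrite -[in RHS](oeA A) !inE.
rewrite (bigU _ _ _ (oeD A)) /= -mulrA mulrCA; congr (_ * _).
  by apply: eq_bigr => m; rewrite inE /tile_weight => /andP[_ ->].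
rewrite -prodr_const -big_split /=; apply: eq_bigr => m; rewrite inE => /andP[_ om].
by rewrite /tile_weight (negPf om) mulN1r.
Qed.

End InvariantsAsPackings.

Section Gradient.
Variables (n : nat) (hn : (5 <= n)%N) (K : numFieldType).
Local Notation Z2n := 'Z_(n.*2).
Implicit Types (m i j : Z2n) (x : corner_space K n).
Local Notation psum := (packing_sum (@overlap n)).

(** The tiles whose weight involves the coordinate x_i. They form a clique, so
E_k has degree at most one in each coordinate. *)
Definition tiles_over i : seq Z2n := if odd i then [:: i] else [:: i - 1; i; i + 1].

(** x_i times the derivative along x_i of a sum of packings. *)
Definition log_derivative k x i : K :=
  \sum_(m <- tiles_over i)
    tile_weight x m
    * psum (tile_weight x) k ([set: Z2n] :\: neighbours (@overlap n) m).

Lemma tile_weight_shift x i h m : x 0 i != 0 ->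
  tile_weight (h *: delta_mx 0 i + x) m
  = tile_weight x m * (if m \in tiles_over i then 1 + h / x 0 i else 1).
Proof.
move=> xi0; rewrite /tile_weight /tiles_over.
have xE j : (h *: delta_mx 0 i + x) 0 j = x 0 j * (if j == i then 1 + h / x 0 i else 1).
  rewrite !mxE eqxx /=; have [->|_] := eqVneq j i; last by rewrite mulr0 add0r mulr1.
  by rewrite mulr1; field.
have om (c : int) : odd (m + c%:~R)%R = odd m (+) odd `|c|%N.
  by rewrite odd_indexD // odd_int.
have mp : odd (m + 1)%R = ~~ odd m by rewrite (om 1) addbT.
have mn : odd (m - 1)%R = ~~ odd m by rewrite (om (-1)) addbT.
have neq (a b : Z2n) : odd a != odd b -> (a == b) = false.
  by apply: contraNF => /eqP ->.
rewrite !xE; case im: (odd m); case ii: (odd i).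
- rewrite (neq (m - 1) i) ?mn ?im ?ii // (neq (m + 1) i) ?mp ?im ?ii // inE.
  by case: eqP => _; ring.
- have ep : (m == i + 1) = (m - 1 == i) by rewrite subr_eq.
  have en : (m == i - 1) = (m + 1 == i) by rewrite -[1]opprK subr_eq opprK.
  rewrite (neq m i) ?im ?ii // !inE [m == i]neq ?im ?ii //= ep en.
  have [e1|e1] := eqVneq (m - 1) i; have [e2|e2] := eqVneq (m + 1) i => /=; try by ring.
  have /eqP[] := small_index_neq0 hn (isT : (0 < `|2%:Z| < 10)%N).
  have -> : 2%:~R = (m + 1) - (m - 1) :> Z2n by ring.
  by rewrite e1 e2 subrr.
- rewrite inE (neq m i) ?im ?ii //; ring.
- have oip : odd (i + 1)%R = true by rewrite odd_indexD // odd_index1 ii.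
  have oin : odd (i - 1)%R = true by rewrite (odd_sub_int hn i 1) ii.
  rewrite !inE [m == i - 1]neq ?oin ?im // [m == i + 1]neq ?oip ?im //=.
  by rewrite orbF; case: eqP => _ /=; ring.
Qed.

Lemma tiles_over_clique i : {in tiles_over i &, forall a b, overlap a b}.
Proof.
rewrite /tiles_over; case oi: (odd i) => a b.
  by rewrite !inE => /eqP-> /eqP->; rewrite overlap_refl.
have [j ->] : exists j : int, i = (2 * j)%:~R.
  by exists (i./2)%:Z; rewrite index_even ?oi.
have cov (c : Z2n) :
    c \in [:: (2 * j)%:~R - 1; (2 * j)%:~R; (2 * j)%:~R + 1] -> covers c j.
  rewrite -[1]/(1%:~R) -intrB -intrD.
  rewrite !inE => /or3P[] /eqP->; rewrite covers_int //; lia.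
by move=> /cov aj /cov; exact: covers_overlap aj.
Qed.

Lemma tiles_over_uniq i : uniq (tiles_over i).
Proof.
rewrite /tiles_over; case: (odd i) => //=.
have m1 := small_index_neq0 hn (isT : (0 < `|1%:Z| < 10)%N).
have m2 := small_index_neq0 hn (isT : (0 < `|2%:Z| < 10)%N).
have e1 : i - 1 - i = - 1%:~R by ring.
have e2 : i - 1 - (i + 1) = - 2%:~R by ring.
have e3 : i - (i + 1) = - 1%:~R by ring.
rewrite !inE -[i - 1 == i]subr_eq0 -[i - 1 == _]subr_eq0 -[i == _]subr_eq0.
by rewrite e1 e2 e3 !oppr_eq0 m1 m2.
Qed.

(** Moving x_i rescales the weights of a clique of tiles and of no other tile, so
the sum is affine in x_i. *)
Lemma psum_shift k x i h : x 0 i != 0 ->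
  psum (tile_weight (h *: delta_mx 0 i + x)) k.+1 [set: Z2n]
  = psum (tile_weight x) k.+1 [set: Z2n] + h / x 0 i * log_derivative k x i.
Proof.
move=> xi0; set w' := tile_weight (_ + x); set w := tile_weight x.
have sub : {subset tiles_over i <= [set: Z2n]} by move=> a; rewrite !inE.
have cl v := @packing_sum_clique _ _ _ (@overlap_refl n) (@overlap_sym n) v k _ _
  (tiles_over_uniq i) (@tiles_over_clique i) sub.
rewrite (cl _ w') (cl _ w).
rewrite -addrA; congr (_ + _).
  apply: eq_packing_sum => m; rewrite !inE andbT => /negPf mi.
  by rewrite /w' tile_weight_shift // mi mulr1.
rewrite /log_derivative mulr_sumr -big_split /=; apply: eq_big_seq => m mi.
rewrite /w' tile_weight_shift // mi -/w' -/w.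
rewrite (_ : psum w' k _
  = psum w k ([set: Z2n] :\: neighbours (@overlap n) m)); first by ring.
apply: eq_packing_sum => a; rewrite !inE andbT => ma.
rewrite /w' tile_weight_shift // ifN ?mulr1 //; apply: contraNN ma => ai.
exact: tiles_over_clique ai.
Qed.

Lemma log_derivativeE k x (j : int) :
  let w := tile_weight x in
  log_derivative k x (2 * j)%:~R
  = w (2 * j)%:~R * gap_sum w k j 2 + w (2 * j - 1)%:~R * gap_sum w k (j - 1) 3
    + w (2 * (j + 1) - 1)%:~R * gap_sum w k j 3
  /\ log_derivative k x (2 * j - 1)%:~R = w (2 * j - 1)%:~R * gap_sum w k (j - 1) 3.
Proof.
move=> w.
have dimerE : [set: Z2n] :\: neighbours (@overlap n) (2 * j)%:~R = gap n j 2.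
  by apply/setP => m; rewrite !gapSl gap0 !inE overlap_dimer // negb_or !andbT.
have trimerE (i : int) :
    [set: Z2n] :\: neighbours (@overlap n) (2 * i - 1)%:~R = gap n (i - 1) 3.
  apply/setP => m; rewrite !gapSl gap0 !inE overlap_trimer //.
  by rewrite !negb_or !andbT subrK.
have o1 : odd ((2 * j)%:~R : Z2n) = false by rewrite odd_int // abszM oddM.
have o2 : odd ((2 * j - 1)%:~R : Z2n) = true by rewrite odd_int //; lia.
rewrite /log_derivative /tiles_over o1 o2 !big_cons !big_nil !addr0 trimerE; split=> //.
rewrite (_ : (2 * j)%:~R - 1 = (2 * j - 1)%:~R :> Z2n); last by rewrite intrB.
rewrite (_ : (2 * j)%:~R + 1 = (2 * (j + 1) - 1)%:~R :> Z2n); last first.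
  by rewrite -[1]/(1%:~R) -intrD; congr _%:~R; lia.
by rewrite dimerE !trimerE addrK /gap_sum -/w; ring.
Qed.

(** The bracket is constant in the logarithms of the coordinates, so the field is
best expressed by the logarithmic derivatives D. *)
Lemma hamiltonian_fieldE (F : corner_space K n -> K) x (D : Z2n -> K) j :
  (forall i, x 0 i != 0) -> (forall i, 'D_(delta_mx 0 i) F x = D i / x 0 i) ->
  hamiltonian_field F x 0 j = (-1) ^+ odd j * x 0 j * (D (j - 2) - D (j + 2)).
Proof.
move=> x0 DE; rewrite mxE /poisson.
have coordE i k : 'D_(delta_mx 0 i) (fun y : corner_space K n => y 0 k) x = (k == i)%:R.
  apply: derive_affine => h; rewrite !mxE eqxx /=.
  by rewrite addrC.
rewrite (eq_bigr (fun i => D i / x 0 i * coord_bracket x i j)); last first.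
  move=> i _; rewrite (bigD1 j) //= big1 ?addr0 ?coordE ?eqxx ?mulr1 ?DE // => k kj.
  by rewrite coordE eq_sym (negPf kj) mulr0 mul0r.
have m4 := small_index_neq0 hn (isT : (0 < `|4%:Z| < 10)%N).
have ne : j + 2 != j - 2.
  by rewrite -subr_eq0 (_ : j + 2 - (j - 2) = 4%:~R) ?m4 //; ring.
have opp : odd (j - 2)%R = odd j by rewrite (odd_sub_int hn j 2) addbF.
have sgn (i : Z2n) : (-1) ^+ i = (-1) ^+ odd i :> K by rewrite signr_odd.
rewrite (bigD1 (j - 2)) //= (bigD1 (j + 2)) //= big1 ?addr0; last first.
  move=> i /andP[i1 i2]; rewrite /coord_bracket.
  rewrite -subr_eq eq_sym (negPf i1) (negPf i2) mulr0 //.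
rewrite /coord_bracket subrK eqxx sgn opp.
rewrite (_ : (j == j + 2 + 2) = false); last first.
  by rewrite -subr_eq eq_sym; exact/negbTE.
by rewrite eqxx sgn; field; rewrite !x0.
Qed.

Lemma derive_monodromy_sum k x i : x 0 i != 0 ->
  'D_(delta_mx 0 i) (@monodromy_sum K n true k.+1) x
  = (log_derivative k.+1 x i - log_derivative k x i) / x 0 i.
Proof.
move=> xi0; apply: derive_affine => h.
rewrite !monodromy_sum_packing // !psum_shift // /GRing.scale /=.
by field.
Qed.

(** The logarithmic derivative along x_{2i} counts the packings in which the
dimer 2i or one of the trimers 2i-1, 2i+1 occurs. Its differences become rates by
the circular expansion, which trades the packings with a tile on a given slot for
those in which this slot is a monomer. The rate of x_{2i-1} is that of
u_i / (s_i s_{i-1}). *)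
Lemma hamiltonian_monodromy_sum k x (i : int) : (forall m, x 0 m != 0) ->
  let w := tile_weight x in
  let X := hamiltonian_field (@monodromy_sum K n true k.+1) x in
  X 0 (2 * i)%:~R = x 0 (2 * i)%:~R * dimer_rate w k i
  /\ X 0 (2 * i - 1)%:~R
     = x 0 (2 * i - 1)%:~R
       * (trimer_rate w k i - dimer_rate w k i - dimer_rate w k (i - 1)).
Proof.
move=> x0 w X; rewrite /X.
have DE m := derive_monodromy_sum k (x0 m).
rewrite !(hamiltonian_fieldE _ x0 DE) {DE X}.
have o1 : odd ((2 * i)%:~R : Z2n) = false by rewrite odd_int // abszM oddM.
have o2 : odd ((2 * i - 1)%:~R : Z2n) = true by rewrite odd_int //; lia.
have en : (2 * i)%:~R - 2 = (2 * (i - 1))%:~R :> Z2n by rewrite mulrBr intrB.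
have ep : (2 * i)%:~R + 2 = (2 * (i + 1))%:~R :> Z2n by rewrite mulrDr intrD.
have on : (2 * i - 1)%:~R - 2 = (2 * (i - 1) - 1)%:~R :> Z2n.
  by rewrite -[2 : Z2n]/(2%:~R) -intrB; congr _%:~R; lia.
have op : (2 * i - 1)%:~R + 2 = (2 * (i + 1) - 1)%:~R :> Z2n.
  by rewrite -[2 : Z2n]/(2%:~R) -intrD; congr _%:~R; lia.
rewrite en ep on op o1 o2 !(log_derivativeE _ _ _).1 !(log_derivativeE _ _ _).2.
have e0 (j : int) : j - 1 + 1 = j := subrK 1 j.
have e1 (j : int) : j + 1 - 1 = j := addrK 1 j.
have e2 (j : int) : j + 1 + 1 = j + 2 by lia.
have e3 (j : int) : j - 1 - 1 = j - 2 by lia.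
have e4 (j : int) : j + 1 - 2 = j - 1 by lia.
have step l : gap_sum w l.+1 (i + 1) 1 = gap_sum w l.+1 i 1
    + w (2 * (i - 1))%:~R * gap_sum w l (i - 1) 2
    + w (2 * (i - 1) - 1)%:~R * gap_sum w l (i - 2) 3
    - w (2 * (i + 1))%:~R * gap_sum w l (i + 1) 2
    - w (2 * (i + 2) - 1)%:~R * gap_sum w l (i + 1) 3.
  apply/eqP; rewrite -subr_eq0; apply/eqP.
  have /= C2 := gap_sum_circular hn w l (i + 1).
  rewrite ?(e0, e1, e2, e3, e4) in C2.
  rewrite -[RHS](subrr (psum w l.+1 [set: Z2n])) {1}C2.
  by rewrite (gap_sum_circular hn w l i); ring.
rewrite /trimer_rate /dimer_rate /trimer_sum /monomer_sum ?(e0, e1, e2, e3, e4) -/w.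
by rewrite !step; split; ring.
Qed.
End Gradient.

(** * The projective plane *)

Section Plane.
Variable K : fieldType.
Implicit Types (p q r s z a b c : 'rV[K]_3).

Definition det3 a b c : K :=
  a 0 0 * (b 0 1 * c 0 2 - b 0 2 * c 0 1)
  - a 0 1 * (b 0 0 * c 0 2 - b 0 2 * c 0 0)
  + a 0 2 * (b 0 0 * c 0 1 - b 0 1 * c 0 0).

Lemma det_nat33 (f : nat -> nat -> K) :
  \det (\matrix_(i < 3, j < 3) f i j)
  = f 0 0 * (f 1 1 * f 2 2 - f 1 2 * f 2 1) - f 0 1 * (f 1 0 * f 2 2 - f 1 2 * f 2 0)
    + f 0 2 * (f 1 0 * f 2 1 - f 1 1 * f 2 0).
Proof.
rewrite (expand_det_row _ 0) !big_ord_recl big_ord0 /cofactor.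
rewrite !(expand_det_row _ 0) !big_ord_recl !big_ord0 /cofactor !det_mx11 !mxE /=.
rewrite /bump /=; ring.
Qed.

Lemma det3E a b c : \det (col_mx (col_mx a b) c : 'M[K]_3) = det3 a b c.
Proof.
pose f (i j : nat) := (if i is i'.+1 then if i' is 0 then b else c else a) 0 (inord j).
have -> : (col_mx (col_mx a b) c : 'M[K]_3) = \matrix_(i < 3, j < 3) f i j.
  apply/matrixP => i j; rewrite !mxE /f inord_val.
  case: splitP => k /= ->; rewrite ?mxE ?ord1 //.
  by case: splitP => l /= ->; rewrite !ord1.
rewrite det_nat33 /f /det3.
have i0 : inord 0 = 0 :> 'I_3 by apply/val_inj; rewrite /= inordK.
have i1 : inord 1 = 1 :> 'I_3 by apply/val_inj; rewrite /= inordK.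
have i2 : inord 2 = 2 :> 'I_3 by apply/val_inj; rewrite /= inordK.
by rewrite i0 i1 i2.
Qed.

Lemma ord3_cases (P : 'I_3 -> Prop) : P 0 -> P 1 -> P 2 -> forall i, P i.
Proof.
move=> P0 P1 P2 [[|[|[|//]]] i3]; [move: P0|move: P1|move: P2];
  by congr P; apply/val_inj.
Qed.

Lemma noncollinearE a b c : noncollinear a b c = (det3 a b c != 0).
Proof.
rewrite -det3E -unitfE -unitmxE -row_full_unit /noncollinear /row_full.
congr (_ == _); apply: eqmx_rank; apply/eqmxP.
exact: eqmx_trans (adds_eqmx (addsmxE a b) (eqmx_refl c)) (addsmxE _ c).
Qed.

Lemma cramer3 a b c z : det3 a b c != 0 ->
  z = (det3 z b c / det3 a b c) *: a + (det3 a z c / det3 a b c) *: b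
      + (det3 a b z / det3 a b c) *: c.
Proof.
rewrite /det3 => D0; apply/rowP; apply: ord3_cases; rewrite !mxE; field.
all: by [].
Qed.

Lemma same_point_scale z p : p != 0 -> same_point z p ->
  exists2 c : K, c != 0 & z = c *: p.
Proof.
move=> p0 /andP[/sub_rVP[c zE] pz]; exists c => //.
apply: contraNneq p0 => c0; move: pz; rewrite zE c0 scale0r.
by move=> /submx0null ->.
Qed.

Lemma scale_same_point (c : K) p : c != 0 -> same_point (c *: p) p.
Proof. by move=> c0; apply/eqmxP; exact: eqmx_scale. Qed.

Lemma same_point_sym m1 m2 (A : 'M[K]_(m1, 3)) (B : 'M[K]_(m2, 3)) :
  same_point A B = same_point B A.
Proof. by rewrite /same_point andbC. Qed.

Lemma same_point_trans m1 m2 m3 (A : 'M[K]_(m1, 3)) (B : 'M[K]_(m2, 3))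
    (C : 'M[K]_(m3, 3)) :
  same_point A B -> same_point B C -> same_point A C.
Proof. by move=> /eqmxP AB /eqmxP BC; apply/eqmxP; exact: eqmx_trans AB BC. Qed.

(** Two lines that span the plane meet in one point, since the ranks of sum and
intersection add up to at most 4. *)
Lemma meet_point p q r s z : row_full (line p q + line r s)%MS ->
  z != 0 -> (z <= line p q)%MS -> (z <= line r s)%MS ->
  same_point (meet (line p q) (line r s)) z.
Proof.
move=> /eqP full z0 zpq zrs; rewrite same_point_sym /same_point.
have zcap : (z <= meet (line p q) (line r s))%MS by rewrite sub_capmx zpq.
have line2 a b : (\rank (line a b) <= 2)%N.
  have := mxrank_adds_leqif a b.
  move=> [+ _] => /leq_trans; apply.
  by rewrite (leq_add (rank_leq_row a) (rank_leq_row b)).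
have cap1 : (\rank (meet (line p q) (line r s)) <= 1)%N.
  have := mxrank_sum_cap (line p q) (line r s); rewrite full => E.
  have := leq_add (line2 p q) (line2 r s); rewrite -E /meet; lia.
rewrite -(geq_leqif (mxrank_leqif_eq zcap)) (leq_trans cap1) //.
by rewrite lt0n mxrank_eq0.
Qed.

Lemma row_free2 a b (x y : K) : row_free (col_mx a b) ->
  x *: a + y *: b = 0 -> x = 0 /\ y = 0.
Proof.
move=> /row_free_inj fr xy0.
have : row_mx x%:M y%:M *m col_mx a b = 0 *m col_mx a b.
  by rewrite mul_row_col !mul_scalar_mx xy0 mul0mx.
move=> /fr; rewrite -[0 in RHS]row_mx0.
move=> /eq_row_mx[/matrixP/(_ 0 0) + /matrixP/(_ 0 0)].
by rewrite !mxE /= !mulr1n => -> ->.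
Qed.

Lemma row_free2P a b :
  (forall x y : K, x *: a + y *: b = 0 -> x = 0 /\ y = 0) -> row_free (col_mx a b).
Proof.
move=> h; apply/inj_row_free => v; rewrite -[v]hsubmxK mul_row_col.
rewrite [lsubmx v]mx11_scalar [rsubmx v]mx11_scalar !mul_scalar_mx.
by move=> /h[-> ->]; rewrite !raddf0 row_mx0.
Qed.

Lemma det3_rot a b c : det3 b c a = det3 a b c.
Proof. by rewrite /det3; ring. Qed.

Lemma det3_comb (x y z : K) a b c :
  det3 a b (x *: a + y *: b + z *: c) = z * det3 a b c.
Proof. by rewrite /det3 !mxE; ring. Qed.

Lemma det3_row_free a b c : det3 a b c != 0 -> row_free (col_mx a b).
Proof.
move=> D0; apply: row_free2P => x y xy0.
have Dx : x * det3 a b c = det3 (x *: a + y *: b) b c by rewrite /det3 !mxE; ring.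
have Dy : y * det3 a b c = det3 a (x *: a + y *: b) c by rewrite /det3 !mxE; ring.
have z1 : det3 0 b c = 0 by rewrite /det3 !mxE; ring.
have z2 : det3 a 0 c = 0 by rewrite /det3 !mxE; ring.
rewrite xy0 in Dx Dy.
by split; apply: (mulIf D0); rewrite mul0r ?Dx ?Dy.
Qed.

Lemma line_comb a b (x y : K) : ((x *: a + y *: b)%R <= line a b)%MS.
Proof. by rewrite /line addmx_sub // scalemx_sub ?addsmxSl ?addsmxSr. Qed.

Lemma det3_lines_full a b c r s : det3 a b c != 0 -> (c <= line r s)%MS ->
  row_full (line a b + line r s)%MS.
Proof.
rewrite -noncollinearE /noncollinear -!sub1mx => full cl.
by apply: submx_trans full _; rewrite addsmxS.
Qed.
End Plane.

(** * Cross-ratios of five consecutive vertices *)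

Section CrossRatio.
Variable K : numFieldType.
Implicit Types (P Q : 'rV[K]_3).

(** The cross-ratio in homogeneous coordinates with respect to its first two
points. From right to left a chart is needed that contains the four points: its
point at infinity P + tau Q is chosen with tau larger in norm than the
coordinates of the third and fourth points, hence different from all four. *)
Lemma cross_ratio_frame m1 m2 m3 m4 (p1 : 'M[K]_(m1, 3)) (p2 : 'M[K]_(m2, 3))
    (p3 : 'M[K]_(m3, 3)) (p4 : 'M[K]_(m4, 3)) P Q (al be ga de c : K) :
  row_free (col_mx P Q) -> be != 0 -> ga != 0 ->
  same_point p1 P -> same_point p2 Q ->
  same_point p3 (al *: P + be *: Q) -> same_point p4 (ga *: P + de *: Q) ->
  cross_ratio p1 p2 p3 p4 c <-> c = (be * ga - al * de) / (be * ga).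
Proof.
move=> PQ be0 ga0 h1 h2 h3 h4; split.
  move=> [a] [b] [t1] [t2] [t3] [t4] [ab [e1 e2 e3 e4] t13 t24 ->].
  have nz t : a + t *: b != 0.
    apply/eqP => abt; have := @row_free2 _ a b 1 t ab.
    by rewrite scale1r => /(_ abt) [/eqP]; rewrite oner_eq0.
  have rescale m (A : 'M[K]_(m, 3)) z t : same_point A z -> same_point A (a + t *: b) ->
      exists2 rho : K, rho != 0 & z = rho *: (a + t *: b).
    move=> Az At; apply: same_point_scale (nz t) _.
    by apply: same_point_trans At; rewrite same_point_sym.
  have [r1 r10 E1] := rescale _ _ _ _ h1 e1.
  have [r2 r20 E2] := rescale _ _ _ _ h2 e2.
  have [r3 r30 E3] := rescale _ _ _ _ h3 e3.
  have [r4 r40 E4] := rescale _ _ _ _ h4 e4.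
  have coords x y z t3' : x *: P + y *: Q = z *: (a + t3' *: b) ->
      x * r1 + y * r2 = z /\ x * r1 * t1 + y * r2 * t2 = z * t3'.
    rewrite E1 E2 => E; have := @row_free2 _ a b (x * r1 + y * r2 - z)
      (x * r1 * t1 + y * r2 * t2 - z * t3') ab.
    case; first by rewrite -[RHS](subrr (z *: (a + t3' *: b))) -{1}E;
      apply/rowP => j; rewrite !mxE; ring.
    by move=> /eqP + /eqP; rewrite !subr_eq0 => /eqP-> /eqP->.
  have [F3 G3] := coords _ _ _ _ E3; have [F4 G4] := coords _ _ _ _ E4.
  have t31 : (t1 - t3) * r3 = be * r2 * (t1 - t2).
    rewrite (_ : _ * r3 = t1 * r3 - r3 * t3); last by ring.
    by rewrite -G3 -F3; ring.
  have t42 : (t2 - t4) * r4 = ga * r1 * (t2 - t1).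
    rewrite (_ : _ * r4 = t2 * r4 - r4 * t4); last by ring.
    by rewrite -G4 -F4; ring.
  have t43 : (t3 - t4) * (r3 * r4) = (be * ga - al * de) * r1 * r2 * (t2 - t1).
    rewrite (_ : (t3 - t4) * (r3 * r4) = r3 * t3 * r4 - r4 * t4 * r3); last by ring.
    by rewrite -G3 -G4 -F3 -F4; ring.
  have t12 : t1 - t2 != 0.
    apply: contraNneq t13 => t12; move/eqP: t31.
    rewrite t12 mulr0 mulf_eq0 (negPf r30) orbF.
    by rewrite subr_eq0.
  have -> : t1 - t3 = be * r2 * (t1 - t2) / r3 by rewrite -t31 mulfK.
  have -> : t2 - t4 = ga * r1 * (t2 - t1) / r4 by rewrite -t42 mulfK.
  have -> : t3 - t4 = (be * ga - al * de) * r1 * r2 * (t2 - t1) / (r3 * r4).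
    by rewrite -t43 mulfK // mulf_neq0.
  have t21 : t2 - t1 != 0 by rewrite -opprB oppr_eq0.
  by field; rewrite t12 t21 be0 ga0 r10 r20 r30 r40.
move=> ->.
pose tau := 1 + `|be / al| + `|de / ga|.
have tau_gt (y : K) : `|y| <= `|be / al| + `|de / ga| -> y - tau != 0.
  move=> ytau; rewrite subr_eq0; apply/eqP => yt; move: ytau.
  have tau0 : 0 <= tau by rewrite !addr_ge0 // ler01.
  by rewrite yt ger0_norm // /tau -addrA gerDr ler10.
have tau0 : tau != 0.
  by rewrite -oppr_eq0 -sub0r tau_gt // normr0 addr_ge0.
have be_tau : be - al * tau != 0.
  have [->|al0] := eqVneq al 0; first by rewrite mul0r subr0.
  have := tau_gt (be / al); rewrite lerDl normr_ge0 => /(_ isT).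
  apply: contraNN => /eqP h; apply/eqP/(mulIf al0); rewrite mul0r -h; field.
  exact: al0.
have de_tau : de - ga * tau != 0.
  have := tau_gt (de / ga); rewrite lerDr normr_ge0 => /(_ isT).
  apply: contraNN => /eqP h; apply/eqP/(mulIf ga0); rewrite mul0r -h; field.
  exact: ga0.
have chart x y : y - x * tau != 0 ->
    same_point (x *: P + y *: Q) (Q + (x / (y - x * tau)) *: (P + tau *: Q)).
  move=> nz.
  have -> : Q + (x / (y - x * tau)) *: (P + tau *: Q)
          = (y - x * tau)^-1 *: (x *: P + y *: Q).
    by apply/rowP => j; rewrite !mxE; field.
  by rewrite same_point_sym; apply: scale_same_point; rewrite invr_eq0.
exists Q, (P + tau *: Q), (- tau^-1), (0 : K), (al / (be - al * tau)),
  (ga / (de - ga * tau)).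
split.
- apply: row_free2P => x y; rewrite addrC scalerDr scalerA -addrA -scalerDl.
  by move=> /(row_free2 PQ)[-> /eqP]; rewrite mul0r add0r => /eqP ->.
- split.
  + apply: same_point_trans h1 _; have := chart 1 0.
    rewrite scale1r scale0r addr0 mul1r sub0r oppr_eq0 => /(_ tau0).
    by rewrite div1r invrN.
  + by apply: same_point_trans h2 _; rewrite scale0r addr0; apply/eqmxP.
  + by apply: same_point_trans h3 _; exact: chart.
  + by apply: same_point_trans h4 _; exact: chart.
- rewrite -subr_eq0 (_ : _ - _ = - be / (tau * (be - al * tau))).
    by rewrite mulf_neq0 ?oppr_eq0 // invr_eq0 mulf_neq0.
  by field; rewrite tau0 be_tau.
- by rewrite eq_sym mulf_neq0 ?invr_eq0.
- field; rewrite de_tau be_tau tau0 ga0 be0 /= andbT.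
  by rewrite (_ : _ + _ = - be) ?oppr_eq0 //; ring.
Qed.

(* P, Q, v0, v1 and v2 are the vertices v_{i-2}, ..., v_{i+2}; the primed
   coefficients belong to the recurrence one step back. *)
Variables (P Q v0 v1 v2 : 'rV[K]_3) (A B C A' B' C' c : K).
Hypotheses (nd : det3 P Q v0 != 0)
  (nA : A != 0) (nB : B != 0) (nA' : A' != 0) (nB' : B' != 0) (nC' : C' != 0)
  (E1 : v1 = A' *: v0 + B' *: Q + C' *: P)
  (E2 : v2 = A *: v1 + B *: v0 + C *: Q).

Lemma cross_ratio_odd :
  cross_ratio P Q (meet (line P Q) (line v0 v1)) (meet (line P Q) (line v1 v2)) c
  <-> c = C * A' / (B * B').
Proof.
have fr := det3_row_free nd.
have free x y : (x *: P + y *: Q == 0) = (x == 0) && (y == 0).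
  apply/eqP/andP => [/(row_free2 fr)[-> ->]|[/eqP-> /eqP->]] //.
  by rewrite !scale0r addr0.
rewrite (@cross_ratio_frame _ _ _ _ _ _ _ _ P Q C' B' (- B * C') (A' * C - B * B')) //;
  rewrite ?mulf_neq0 ?oppr_eq0 //.
- by split=> ->; field; rewrite ?nB ?nB' ?nC'.
- exact/eqmxP.
- exact/eqmxP.
- apply: meet_point.
  + by apply: det3_lines_full nd _; rewrite addsmxSl.
  + by rewrite free (negPf nB') andbF.
  + exact: line_comb.
  + (* By the recurrence, C' P + B' Q = v1 - A' v0. *)
    rewrite (_ : _ + _ = - A' *: v0 + 1 *: v1) ?line_comb //.
    by rewrite E1; apply/rowP => j; rewrite !mxE; ring.
- apply: meet_point.
  + apply: (@det3_lines_full _ _ _ v1); last by rewrite addsmxSl.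
    rewrite E1 (_ : _ + _ = C' *: P + B' *: Q + A' *: v0); last first.
      by apply/rowP => j; rewrite !mxE; ring.
    by rewrite det3_comb mulf_neq0.
  + by rewrite free mulf_eq0 oppr_eq0 (negPf nB) (negPf nC').
  + exact: line_comb.
  + (* Eliminate v0 from the two recurrences. *)
    rewrite (_ : _ + _ = - (A * A' + B) *: v1 + A' *: v2) ?line_comb //.
    by rewrite E2 E1; apply/rowP => j; rewrite !mxE; ring.
Qed.

Lemma cross_ratio_even :
  cross_ratio v2 v1 (meet (line v2 v1) (line v0 Q)) (meet (line v2 v1) (line Q P)) c
  <-> c = - B / (A * A').
Proof.
have ndQ : det3 v2 v1 Q != 0.
  have -> : det3 v2 v1 Q = B * C' * det3 P Q v0 by rewrite E2 E1 /det3 !mxE; ring.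
  by rewrite !mulf_neq0.
have fr := det3_row_free ndQ.
have free x y : (x *: v2 + y *: v1 == 0) = (x == 0) && (y == 0).
  apply/eqP/andP => [/(row_free2 fr)[-> ->]|[/eqP-> /eqP->]] //.
  by rewrite !scale0r addr0.
rewrite (@cross_ratio_frame _ _ _ _ _ _ _ _ v2 v1 1 (- A) A' (- (A * A' + B))) //;
  rewrite ?oppr_eq0 //.
- by split=> ->; field; rewrite ?nA ?nA'.
- exact/eqmxP.
- exact/eqmxP.
- apply: meet_point.
  + by apply: det3_lines_full ndQ _; rewrite addsmxSr.
  + by rewrite free oner_eq0.
  + exact: line_comb.
  + rewrite (_ : _ + _ = B *: v0 + C *: Q) ?line_comb //.
    by rewrite E2; apply/rowP => j; rewrite !mxE; ring.
- apply: meet_point.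
  + by apply: det3_lines_full ndQ _; rewrite addsmxSl.
  + by rewrite free (negPf nA').
  + exact: line_comb.
  + rewrite (_ : _ + _ = (A' * C - B * B') *: Q + (- B * C') *: P) ?line_comb //.
    by rewrite E2 E1; apply/rowP => j; rewrite !mxE; ring.
Qed.
End CrossRatio.

(** * Polygons and their recurrence *)

Section Coefficients.
Variable K : fieldType.
Implicit Types (v : int -> 'rV[K]_3) (i : int).

(** The coefficients of v_{i+2} in the basis v_{i+1}, v_i, v_{i-1}, by Cramer's
rule. *)
Definition vol v i := det3 (v (i - 1)) (v i) (v (i + 1)).
Definition coefA v i := det3 (v (i - 1)) (v i) (v (i + 2)) / vol v i.
Definition coefB v i := det3 (v (i - 1)) (v (i + 2)) (v (i + 1)) / vol v i.
Definition coefC v i := det3 (v (i + 2)) (v i) (v (i + 1)) / vol v i.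

(** The two expressions are invariant under rescaling of the vectors v_i. *)
Definition corner_odd v i := coefC v i * coefA v (i - 1) / (coefB v i * coefB v (i - 1)).
Definition corner_even v i := - coefB v i / (coefA v i * coefA v (i - 1)).

Definition generic_at v i : bool :=
  [&& vol v i != 0, coefA v i != 0, coefB v i != 0 & coefC v i != 0].

Lemma det3_swap (a b c : 'rV[K]_3) : det3 a c b = - det3 a b c.
Proof. by rewrite /det3; ring. Qed.

Lemma genericP v : generic v <-> forall i, generic_at v i.
Proof.
have e1 i : i - 1 + 1 = i := subrK 1 i.
have e2 i : i - 1 + 2 = i + 1 by lia.
have e3 i : i - 1 + 3 = i + 2 by lia.
have E i : generic_at v i = [&& noncollinear (v (i - 1)) (v i) (v (i + 1)),
    noncollinear (v (i - 1)) (v i) (v (i + 2)),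
    noncollinear (v (i - 1)) (v (i + 1)) (v (i + 2))
    & noncollinear (v i) (v (i + 1)) (v (i + 2))].
  rewrite !noncollinearE /generic_at /coefA /coefB /coefC -/(vol v i) !mulf_eq0 !invr_eq0.
  rewrite (det3_swap (v (i - 1)) (v (i + 1)) (v (i + 2))) oppr_eq0.
  rewrite (det3_rot (v (i + 2)) (v i) (v (i + 1))).
  by case: (vol v i == 0); rewrite ?orbF.
split=> [gen i | gen i].
  by rewrite E; have := gen (i - 1); rewrite e1 e2 e3 => -[-> -> -> ->].
have e4 : i + 1 + 1 = i + 2 by lia.
have e5 : i + 1 + 2 = i + 3 by lia.
by have := gen (i + 1); rewrite E addrK e4 e5 => /and4P[].
Qed.

Lemma recurrence v i : vol v i != 0 ->
  v (i + 2) = coefA v i *: v (i + 1) + coefB v i *: v i + coefC v i *: v (i - 1).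
Proof. by move=> v0; rewrite {1}(cramer3 (v (i + 2)) v0) addrC addrA addrAC. Qed.

End Coefficients.

Lemma generic_corner_invariants (K : numFieldType) n (v : int -> 'rV[K]_3) x :
  generic v ->
  @corner_invariants K n v x <->
  forall i, x 0 (2 * i - 1)%:~R = corner_odd v i /\ x 0 (2 * i)%:~R = corner_even v i.
Proof.
move/genericP => gen; suff E (i : int) c :
    (cross_ratio (v (i - 2)) (v (i - 1))
      (meet (line (v (i - 2)) (v (i - 1))) (line (v i) (v (i + 1))))
      (meet (line (v (i - 2)) (v (i - 1))) (line (v (i + 1)) (v (i + 2)))) c
      <-> c = corner_odd v i) /\
    (cross_ratio (v (i + 2)) (v (i + 1))
      (meet (line (v (i + 2)) (v (i + 1))) (line (v i) (v (i - 1))))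
      (meet (line (v (i + 2)) (v (i + 1))) (line (v (i - 1)) (v (i - 2)))) c
      <-> c = corner_even v i).
  by split=> h i; move: (h i) => [/(E i _).1 h1 /(E i _).2 h2].
have /and4P[v0 A0 B0 C0] := gen i; have /and4P[v0' A0' B0' C0'] := gen (i - 1).
have E2 := recurrence v0; have E1 := recurrence v0'.
have e1 : i - 1 + 2 = i + 1 by lia.
have e2 : i - 1 - 1 = i - 2 by lia.
rewrite e1 e2 subrK in E1.
have nd : det3 (v (i - 2)) (v (i - 1)) (v i) != 0.
  by move: v0'; rewrite /vol e2 subrK.
split; first exact: (cross_ratio_odd c nd B0 A0' B0' C0' E1 E2).
exact: (cross_ratio_even c nd A0 B0 A0' C0' E1 E2).
Qed.

Section Representatives.
Variable K : fieldType.
Implicit Types (p q r : 'rV[K]_3).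

Lemma eq_noncollinear p q r p' q' r' : same_point p p' -> same_point q q' ->
  same_point r r' -> noncollinear p q r = noncollinear p' q' r'.
Proof.
move=> /eqmxP pp /eqmxP qq /eqmxP rr; rewrite /noncollinear /row_full.
by congr (_ == _); apply: eqmx_rank; apply/eqmxP; do 2?apply: adds_eqmx.
Qed.

Lemma eq_cross_ratio m1 m2 m3 m4 (p1 p1' : 'M[K]_(m1, 3)) (p2 p2' : 'M[K]_(m2, 3))
    (p3 p3' : 'M[K]_(m3, 3)) (p4 p4' : 'M[K]_(m4, 3)) c :
  same_point p1' p1 -> same_point p2' p2 -> same_point p3' p3 -> same_point p4' p4 ->
  cross_ratio p1 p2 p3 p4 c -> cross_ratio p1' p2' p3' p4' c.
Proof.
move=> h1 h2 h3 h4 [a] [b] [t1] [t2] [t3] [t4] [ab [e1 e2 e3 e4] t13 t24 cE].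
exists a, b, t1, t2, t3, t4; split=> //.
by split; [exact: same_point_trans e1 | exact: same_point_trans e2
  | exact: same_point_trans e3 | exact: same_point_trans e4].
Qed.

Lemma eq_meet p q r (s : 'rV[K]_3) p' q' r' (s' : 'rV[K]_3) :
  same_point p p' -> same_point q q' -> same_point r r' -> same_point s s' ->
  same_point (meet (line p q) (line r s)) (meet (line p' q') (line r' s')).
Proof.
move=> /eqmxP pp /eqmxP qq /eqmxP rr /eqmxP ss.
by apply/eqmxP; apply: cap_eqmx; apply: adds_eqmx.
Qed.

Lemma eq_generic (v v' : int -> 'rV[K]_3) :
  (forall i, same_point (v' i) (v i)) -> generic v -> generic v'.
Proof.
move=> vv gen i; have [g1 g2 g3 g4] := gen i.
by split; rewrite (eq_noncollinear (vv _) (vv _) (vv _)).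
Qed.

Lemma eq_corner_invariants n (v v' : int -> 'rV[K]_3) x :
  (forall i, same_point (v' i) (v i)) ->
  corner_invariants (n := n) v x -> corner_invariants v' x.
Proof.
move=> vv h i; have [h1 h2] := h i.
by split; [apply: eq_cross_ratio h1 | apply: eq_cross_ratio h2] => //; apply: eq_meet.
Qed.
End Representatives.

Lemma int_period (T : Type) (n : nat) (f : int -> T) :
  (forall i, f (i + n%:Z) = f i) -> forall i (q : int), f (i + q * n%:Z) = f i.
Proof.
move=> fn i q; have pos (j : int) (k : nat) : f (j + k%:Z * n%:Z) = f j.
  elim: k => [|k IH]; first by rewrite mul0r addr0.
  by rewrite -addn1 PoszD mulrDl mul1r addrA fn.
case: q => k; first exact: pos.
by rewrite NegzE mulNr -[in RHS](subrK (k.+1%:Z * n%:Z) i) pos.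
Qed.

(** A scalar monodromy only rescales the vectors, so the vertices have
representatives that are periodic as vectors. *)
Lemma closed_ngonsP (K : numFieldType) n x : (0 < n)%N ->
  @closed_ngons K n x <-> exists v : int -> 'rV[K]_3,
    [/\ forall i, v (i + n%:Z) = v i, generic v
      & forall i, x 0 (2 * i - 1)%:~R = corner_odd v i
                  /\ x 0 (2 * i)%:~R = corner_even v i].
Proof.
move=> n0; split.
  move=> [v] [M] [[v_neq0 Mu vM] gen /is_scalar_mxP[a Ma] cor].
  have a0 : a != 0.
    by move: Mu; rewrite Ma unitmxE det_scalar unitfE expf_eq0.
  have vn i : same_point (v (i + n%:Z)) (v i).
    apply: same_point_trans (vM i) _; rewrite Ma mul_mx_scalar.
    exact: scale_same_point.
  have vq (q i : int) : same_point (v (i + q * n%:Z)) (v i).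
    have pos (j : int) (k : nat) : same_point (v (j + k%:Z * n%:Z)) (v j).
      elim: k => [|k IH]; first by rewrite mul0r addr0; apply/eqmxP.
      rewrite -[k.+1]addn1 PoszD mulrDl mul1r addrA; exact: same_point_trans (vn _) IH.
    case: q => k; first exact: pos.
    rewrite same_point_sym NegzE mulNr -[i in v i](subrK (k.+1%:Z * n%:Z) i).
    exact: pos.
  pose v' i := v (i %% n%:Z)%Z.
  have vv i : same_point (v' i) (v i).
    by rewrite {2}(divz_eq i n%:Z) addrC same_point_sym; exact: vq.
  have gen' := eq_generic vv gen.
  exists v'; split=> //; first by move=> i; rewrite /v' modzDr.
  exact/(generic_corner_invariants x gen')/(eq_corner_invariants vv).
move=> [v] [vn gen cor]; exists v, 1%:M; split=> //.
- split; last by move=> i; rewrite mulmx1 vn; apply/eqmxP.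
  + move=> i; have /genericP/(_ i)/and4P[+ _ _ _] := gen.
    apply: contraNneq => v0; rewrite /vol v0 /det3 !mxE; apply/eqP; ring.
  + exact: unitmx1.
- exact: scalar_mx_is_scalar.
- exact/(generic_corner_invariants x gen).
Qed.

(** * Differentiable germs of curves *)

Section Germs.
Variable K : numFieldType.
Implicit Types (f g : K -> K) (a b : K).

(** Differentiability near 0 and the derivative at 0 travel together through the
computation of the corner invariants of a moving polygon. *)
Definition germ f a : Prop :=
  (\forall t \near (0 : K), derivable f t 1) /\ is_derive (0 : K) 1 f a.

Lemma germ_cst c : germ (fun=> c) 0.
Proof.
by split; [near=> t; exact: derivable_cst | exact: is_derive_cst].
Unshelve. all: by end_near. Qed.

Lemma germ_id : germ id 1.
Proof.
by split; [near=> t; exact: derivable_id | exact: is_derive_id].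
Unshelve. all: by end_near. Qed.

Lemma eq_germ f g a b : f =1 g -> a = b -> germ f a -> germ g b.
Proof. by move=> /funext -> ->. Qed.

Lemma germD f g a b : germ f a -> germ g b -> germ (fun t => f t + g t) (a + b).
Proof.
move=> [nf df] [ng dg]; split; last exact: is_deriveD.
by apply: filterS2 nf ng => t; exact: derivableD.
Qed.

Lemma germN f a : germ f a -> germ (fun t => - f t) (- a).
Proof.
move=> [nf df]; split; last exact: is_deriveN.
by apply: filterS nf => t; exact: derivableN.
Qed.

Lemma germM f g a b : germ f a -> germ g b ->
  germ (fun t => f t * g t) (a * g 0 + f 0 * b).
Proof.
move=> [nf df] [ng dg]; split.
  by apply: filterS2 nf ng => t; exact: derivableM.
apply: (is_derive_eq (is_deriveM df dg)).
by rewrite /GRing.scale /= addrC mulrC.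
Qed.

Lemma germ_continuous f a : germ f a -> {for 0, continuous f}.
Proof.
by move=> [_ [df _]]; apply/differentiable_continuous/derivable1_diffP.
Qed.

Lemma germ_neq0 f a : germ f a -> f 0 != 0 -> \forall t \near (0 : K), f t != 0.
Proof.
move=> gf f0; have := germ_continuous gf => cf.
exact: cvgr_neq0 cf f0.
Qed.

Lemma germV f a : germ f a -> f 0 != 0 -> germ (fun t => (f t)^-1) (- a / f 0 ^+ 2).
Proof.
move=> gf f0; have nz := germ_neq0 gf f0; case: gf => nf df; split.
  by apply: filterS2 nz nf => t; exact: derivableV.
have [dfx dfE] := df.
apply: DeriveDef; first exact: derivableV.
by rewrite deriveV // dfE /GRing.scale /= mulNr mulrC mulNr.
Qed.

(** The tangent condition read coordinate by coordinate, a form that is stable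
under permutations of the coordinates. *)
Definition tangent_coordinates m (S : set 'rV[K]_m) (p w : 'rV[K]_m) : Prop :=
  exists gamma : K -> 'rV[K]_m,
    [/\ gamma 0 = p, \forall t \near (0 : K), S (gamma t)
      & forall j, germ (fun t => gamma t 0 j) (w 0 j)].

Lemma tangent_coordinatesP m (S : set 'rV[K]_m) (p w : 'rV[K]_m) :
  tangent_coordinates S p w -> tangent_space S p w.
Proof.
move=> [gamma [<- Sg gg]]; exists gamma.
have gE : gamma = \sum_j (fun t => gamma t 0 j *: delta_mx 0 j).
  by apply/funext => t; rewrite [LHS]row_sum_delta fct_sumE.
have diffj (t : K) j : derivable (fun s => gamma s 0 j) t 1 ->
    is_derive t 1 (fun s => gamma s 0 j *: (delta_mx 0 j : 'rV[K]_m))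
      ('D_1 (fun s => gamma s 0 j) t *: delta_mx 0 j).
  move=> dj; have dj' : differentiable (fun s => gamma s 0 j) t by exact/derivable1_diffP.
  apply: DeriveDef; first exact/derivable1_diffP/differentiableZl.
  rewrite deriveE ?deriveE //; last exact: differentiableZl.
  by rewrite diffZl.
have dE (t : K) : (forall j, derivable (fun s => gamma s 0 j) t 1) ->
    is_derive t 1 gamma (\sum_j 'D_1 (fun s => gamma s 0 j) t *: delta_mx 0 j).
  by move=> dj; rewrite {1}gE; apply: is_derive_sum => j; exact: diffj.
split=> //.
- have nd : \forall t \near (0 : K), forall j, derivable (fun s => gamma s 0 j) t 1.
    apply: (@filter_forall _ _
      (fun j t => derivable (fun s => gamma s 0 j) t 1) (nbhs (0 : K)) _).
    by move=> j; exact: (gg j).1.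
  near=> t; have dt : forall j, derivable (fun s => gamma s 0 j) t 1 by near: t.
  by have [] := dE _ dt.
- have d0 j : derivable (fun s => gamma s 0 j) 0 1 by have [_ []] := gg j.
  apply: (is_derive_eq (dE _ d0)); rewrite [RHS]row_sum_delta.
  by apply: eq_bigr => j _; have [_ [_ ->]] := gg j.
Unshelve. all: by end_near. Qed.

End Germs.

(** * Corner invariants of a moving polygon *)

Section Variation.
Variable K : numFieldType.
Implicit Types (a b c d : 'rV[K]_3) (v V : int -> 'rV[K]_3) (i : int).

Definition det3_var a b c a' b' c' := det3 a' b c + det3 a b' c + det3 a b c'.

Lemma germ_det3 a b c a' b' c' :
  germ (fun t => det3 (a + t *: a') (b + t *: b') (c + t *: c')) (det3_var a b c a' b' c').
Proof.
have g (z z' : 'rV[K]_3) (j : 'I_3) : germ (fun t : K => (z + t *: z') 0 j) (z' 0 j).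
  apply: eq_germ (germD (germ_cst (z 0 j)) (germM (@germ_id K) (germ_cst (z' 0 j)))).
    by move=> t; rewrite !mxE.
  by rewrite add0r mul1r mulr0 addr0.
pose minor j1 j2 := germD (germM (g b b' j1) (g c c' j2))
  (germN (germM (g b b' j2) (g c c' j1))).
apply: eq_germ (germD (germD (germM (g a a' 0) (minor 1 2))
  (germN (germM (g a a' 1) (minor 0 2)))) (germM (g a a' 2) (minor 0 1))) => //.
by rewrite /det3_var /det3 !mxE; ring.
Qed.

(** In the variations of the numerators of A, B and C, a multiple of D' comes from
the motion of the basis; what remains is due to sigma and upsilon. *)
Lemma det3_var_comb (A B C sigma upsilon : K) a b c a' b' c' :
  let d := A *: c + B *: b + C *: a in
  let d' := A *: c' + B *: (b' + sigma *: b) + C *: (a' + upsilon *: a) in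
  let D := det3 a b c in let D' := det3_var a b c a' b' c' in
  [/\ det3_var a b d a' b' d' = A * D',
      det3_var a d c a' d' c' = B * D' + B * sigma * D
    & det3_var d b c d' b' c' = C * D' + C * upsilon * D].
Proof. by rewrite /det3_var /det3 /= !mxE; split; ring. Qed.

Definition moved v V (t : K) : int -> 'rV[K]_3 := fun i => v i + t *: V i.

(** The linearized recurrence: to first order, the motion V keeps the coefficient
A_i and multiplies B_i and C_i with the rates sigma i and upsilon i. *)
Definition deforms v V (sigma upsilon : int -> K) i : Prop :=
  V (i + 2) = coefA v i *: V (i + 1) + coefB v i *: (V i + sigma i *: v i)
            + coefC v i *: (V (i - 1) + upsilon i *: v (i - 1)).

Lemma germ_vol v V i : germ (fun t => vol (moved v V t) i)
  (det3_var (v (i - 1)) (v i) (v (i + 1)) (V (i - 1)) (V i) (V (i + 1))).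
Proof. exact: germ_det3. Qed.

Lemma moved0 v V : moved v V 0 = v.
Proof. by apply/funext => i; rewrite /moved scale0r addr0. Qed.

Lemma germ_coef v V sigma upsilon i : generic_at v i -> deforms v V sigma upsilon i ->
  [/\ germ (fun t => coefA (moved v V t) i) 0,
      germ (fun t => coefB (moved v V t) i) (coefB v i * sigma i)
    & germ (fun t => coefC (moved v V t) i) (coefC v i * upsilon i)].
Proof.
move=> /and4P[v0 _ _ _] dV; have vE := recurrence v0; rewrite /deforms in dV.
have [vA vB vC] := det3_var_comb (coefA v i) (coefB v i) (coefC v i) (sigma i) (upsilon i)
  (v (i - 1)) (v i) (v (i + 1)) (V (i - 1)) (V i) (V (i + 1)).
rewrite -vE -dV in vA vB vC.
have gV := germV (germ_vol v V i).
rewrite moved0 in gV; have {}gV := gV v0.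
have q (N D N' D' c : K) : D != 0 -> N' = N / D * D' + c * D ->
   N' * D^-1 + N * (- D' / D ^+ 2) = c.
  by move=> D0 ->; field.
split; apply: eq_germ (germM (germ_det3 _ _ _ _ _ _) gV) => //=;
  rewrite !moved0 !scale0r !addr0; apply: q => //.
by rewrite vA mul0r addr0.
Qed.

Lemma germ_corner v V sigma upsilon i :
  generic_at v i -> generic_at v (i - 1) ->
  deforms v V sigma upsilon i -> deforms v V sigma upsilon (i - 1) ->
  germ (fun t => corner_even (moved v V t) i) (corner_even v i * sigma i)
  /\ germ (fun t => corner_odd (moved v V t) i)
    (corner_odd v i * (upsilon i - sigma i - sigma (i - 1))).
Proof.
move=> g1 g2 d1 d2.
have [a1 b1 c1] := germ_coef g1 d1; have [a2 b2 c2] := germ_coef g2 d2.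
have /and4P[_ A1 B1 C1] := g1; have /and4P[_ A2 B2 C2] := g2.
split.
  have gV := germV (germM a1 a2); rewrite !moved0 mulf_neq0 // in gV.
  apply: eq_germ (germM (germN b1) (gV isT)) => //.
  by rewrite /corner_even !moved0; field; rewrite A1 A2.
have gV := germV (germM b1 b2); rewrite !moved0 mulf_neq0 // in gV.
apply: eq_germ (germM (germM c1 a2) (gV isT)) => //.
by rewrite /corner_odd !moved0; field; rewrite B1 B2.
Qed.

End Variation.

(** * Curves of closed polygons *)

Section Closed.
Variables (n : nat) (hn : (5 <= n)%N) (K : numFieldType).
Local Notation Z2n := 'Z_(n.*2).
Implicit Types (v V : int -> 'rV[K]_3) (i : int).

Lemma index_int_mod i j : (2 * i)%:~R = (2 * j)%:~R :> Z2n ->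
  exists q : int, i = j + q * n%:Z.
Proof.
move=> ij; exists ((i - j) %/ n%:Z)%Z.
have n0 : n%:Z != 0 by lia.
have r0 := modz_ge0 (i - j) n0; have rn := ltz_pmod (i - j) (_ : 0 < n%:Z).
have dE := divz_eq (i - j) n%:Z.
set r := modz _ _ in dE r0 rn; set q := divz _ _ in dE *.
have {}rn : r < n%:Z by apply: rn; lia.
suff /eqP : r == 0 by move: dE; lia.
have : (2 * r)%:~R == 0%:~R :> Z2n.
  rewrite (_ : 2 * r = 2 * (i - j) + (- q) * (2 * n%:Z)); last by rewrite dE; ring.
  rewrite intrD [(- q * _)%:~R]intrM (_ : (2 * n%:Z)%:~R = 0 :> Z2n); last first.
    by have := index_period hn 0; rewrite add0r mulr0.
  by rewrite mulr0 addr0 mulrBr intrB ij subrr.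
rewrite index_int_eq //; lia.
Qed.

Lemma index_int_periodic (T : Type) (f : int -> T) i j :
  (forall i, f (i + n%:Z) = f i) -> (2 * i)%:~R = (2 * j)%:~R :> Z2n -> f i = f j.
Proof. by move=> fn /index_int_mod[q ->]; rewrite (int_period fn). Qed.

Lemma periodic_coefs v : (forall i, v (i + n%:Z) = v i) -> forall i,
  [/\ vol v (i + n%:Z) = vol v i, coefA v (i + n%:Z) = coefA v i,
      coefB v (i + n%:Z) = coefB v i & coefC v (i + n%:Z) = coefC v i].
Proof.
move=> vn i; have sh (l : int) : v (i + n%:Z + l) = v (i + l) by rewrite addrAC vn.
by rewrite /coefA /coefB /coefC /vol !(sh, vn).
Qed.

Lemma periodic_corners v : (forall i, v (i + n%:Z) = v i) -> forall i,
  corner_odd v (i + n%:Z) = corner_odd v i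
  /\ corner_even v (i + n%:Z) = corner_even v i.
Proof.
move=> vn i; have [_ a b c] := periodic_coefs vn i.
have [_ a' b' c'] := periodic_coefs vn (i - 1).
by rewrite /corner_odd /corner_even [i + n%:Z - 1]addrAC a a' b b' c.
Qed.

(** An even index j is 2i for i = j/2, an odd one is 2i - 1 for i = (j+1)/2. *)
Definition polygon_corners v : corner_space K n :=
  \row_j (if odd j then corner_odd v (uphalf j)%:Z else corner_even v (j./2)%:Z).

Lemma polygon_cornersE v i : (forall i, v (i + n%:Z) = v i) ->
  polygon_corners v 0 (2 * i - 1)%:~R = corner_odd v i
  /\ polygon_corners v 0 (2 * i)%:~R = corner_even v i.
Proof.
move=> vn.
have o1 : odd ((2 * i)%:~R : Z2n) = false by rewrite odd_int // abszM oddM.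
have o2 : odd ((2 * i - 1)%:~R : Z2n) = true by rewrite odd_int //; lia.
rewrite !mxE o1 o2; split.
  apply: index_int_periodic => [j|]; first by have [] := periodic_corners vn j.
  have := index_odd (m := (2 * i - 1)%:~R : Z2n) (o2 : is_true _).
  by rewrite !intrB => /addIr.
apply: index_int_periodic => [j|]; first by have [] := periodic_corners vn j.
by rewrite index_even // o1.
Qed.

(** The polygons v + t V are closed because V is periodic, and generic for small t
because, by periodicity, genericity consists of finitely many open conditions. *)
Lemma polygon_curve_tangent v V sigma upsilon (w : corner_space K n) :
  (forall i, v (i + n%:Z) = v i) -> (forall i, V (i + n%:Z) = V i) ->
  generic v -> (forall i, deforms v V sigma upsilon i) ->
  (forall i, w 0 (2 * i)%:~R = corner_even v i * sigma i
    /\ w 0 (2 * i - 1)%:~R = corner_odd v i * (upsilon i - sigma i - sigma (i - 1))) ->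
  tangent_coordinates (@closed_ngons K n) (polygon_corners v) w.
Proof.
move=> vn Vn /genericP gen dV wE.
have mn t i : moved v V t (i + n%:Z) = moved v V t i by rewrite /moved vn Vn.
exists (fun t => polygon_corners (moved v V t)); split; first by rewrite moved0.
  have near_gen i : \forall t \near (0 : K), generic_at (moved v V t) i.
    have /and4P[v0 a0 b0 c0] := gen i; have [ga gb gc] := germ_coef (gen i) (dV i).
    have nv := germ_neq0 (germ_vol v V i); have na := germ_neq0 ga.
    have nb := germ_neq0 gb; have nc := germ_neq0 gc.
    rewrite moved0 in nv; rewrite moved0 in na.
    rewrite moved0 in nb; rewrite moved0 in nc.
    near=> t; apply/and4P; split; near: t;
      by [exact: nv | exact: na | exact: nb | exact: nc].
  have : \forall t \near (0 : K), forall i : 'I_n, generic_at (moved v V t) i%:Z.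
    apply: (@filter_forall _ _
      (fun (i : 'I_n) t => generic_at (moved v V t) i%:Z) (nbhs (0 : K)) _).
    by move=> i; exact: near_gen.
  apply: filterS => t gt; apply/closed_ngonsP; first by lia.
  exists (moved v V t); split=> //; last by move=> i; exact: polygon_cornersE.
  apply/genericP => i.
  have n0 : n%:Z != 0 by lia.
  have r0 := modz_ge0 i n0; have rn := ltz_pmod i (_ : 0 < n%:Z).
  rewrite (divz_eq i n%:Z) addrC (@int_period _ n (generic_at (moved v V t))); last first.
    by move=> j; rewrite /generic_at; have [-> -> -> ->] := periodic_coefs (mn t) j.
  have {}rn : (`|(i %% n%:Z)%Z|%N < n)%N by move: (rn ltac:(lia)); lia.
  by have := gt (Ordinal rn); rewrite /= gez0_abs.
move=> m; case om: (odd m).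
  rewrite -(index_odd om); set i := (uphalf m)%:Z.
  have [_ go] := germ_corner (gen i) (gen (i - 1)) (dV i) (dV (i - 1)).
  apply: eq_germ go; last by rewrite (wE i).2.
  by move=> t; rewrite (polygon_cornersE _ (mn t)).1.
rewrite -(index_even (negbT om)); set i := (m./2)%:Z.
have [ge _] := germ_corner (gen i) (gen (i - 1)) (dV i) (dV (i - 1)).
apply: eq_germ ge; last by rewrite (wE i).1.
by move=> t; rewrite (polygon_cornersE _ (mn t)).2.
Unshelve. all: by end_near. Qed.
End Closed.

(** * Tangency for E_k, and Casimir functions *)

Section Tangency.
Variables (n : nat) (hn : (5 <= n)%N) (K : numFieldType).
Local Notation Z2n := 'Z_(n.*2).
Implicit Types (x p : corner_space K n).

Lemma gap_sum_periodic (F : comNzRingType) (w : Z2n -> F) k l (i : int) :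
  gap_sum w k (i + n%:Z) l = gap_sum w k i l.
Proof.
rewrite /gap_sum; congr packing_sum; apply/setP => m; rewrite !gapP.
by apply: eq_all => e; rewrite /covers [i + _ + _]addrAC index_period.
Qed.

Lemma closed_neq0 p : closed_ngons p -> forall m : Z2n, p 0 m != 0.
Proof.
move=> /closed_ngonsP[|v [_ /genericP gen cor] m]; first by lia.
case om: (odd m).
  rewrite -(index_odd om) (cor _).1 /corner_odd.
  have /and4P[_ _ b c] := gen (uphalf m)%:Z.
  have /and4P[_ a' b' _] := gen ((uphalf m)%:Z - 1).
  by apply: mulf_neq0; rewrite ?invr_eq0; exact: mulf_neq0.
rewrite -(index_even (negbT om)) (cor _).2 /corner_even.
have /and4P[_ a b _] := gen (m./2)%:Z; have /and4P[_ a' _ _] := gen ((m./2)%:Z - 1).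
by apply: mulf_neq0; [rewrite oppr_eq0 | rewrite invr_eq0; exact: mulf_neq0].
Qed.

(** V is the motion of the rescaled vertices, transported back to the periodic
vectors v_i, for which the coefficients A_i are arbitrary. *)
Lemma tangent_monodromy_sum k p : closed_ngons p ->
  tangent_coordinates (@closed_ngons K n) p
    (hamiltonian_field (@monodromy_sum K n true k.+1) p).
Proof.
move=> cp; have p0 := closed_neq0 cp.
have /closed_ngonsP[|v [vn gv cor]] := cp; first by lia.
have pE : polygon_corners n v = p.
  apply/rowP => m; rewrite mxE; case om: (odd m).
    by rewrite -{2}(index_odd om) (cor _).1.
  by rewrite -{2}(index_even (negbT om)) (cor _).2.
have /genericP gen := gv.
pose w := tile_weight p; pose A := coefA v.
have A0 i : A i != 0 by have /and4P[] := gen i.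
have wB i : coefB v i = w (2 * i)%:~R * A i * A (i - 1).
  have o1 : odd ((2 * i)%:~R : Z2n) = false by rewrite odd_int // abszM oddM.
  by rewrite /w /tile_weight o1 (cor _).2 /corner_even -/A; field; rewrite !A0.
have wC i : coefC v i = w (2 * i - 1)%:~R * A i * A (i - 1) * A (i - 2).
  have o2 : odd ((2 * i - 1)%:~R : Z2n) = true by rewrite odd_int //; lia.
  have e1 : (2 * i - 1)%:~R - 1 = (2 * (i - 1))%:~R :> Z2n.
    by rewrite -[1 : Z2n]/(1%:~R) -intrB; congr _%:~R; lia.
  have e2 : (2 * i - 1)%:~R + 1 = (2 * i)%:~R :> Z2n.
    by rewrite -[1 : Z2n]/(1%:~R) -intrD; congr _%:~R; lia.
  have e3 : i - 1 - 1 = i - 2 by lia.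
  have /and4P[_ _ b _] := gen i; have /and4P[_ _ b' _] := gen (i - 1).
  rewrite /w /tile_weight o2 e1 e2 (cor _).1 !(cor _).2 /corner_odd /corner_even e3 -/A.
  by field; rewrite !A0 b b'.
pose V i := (gap_sum w k.+1 i 1 / A (i - 1)) *: v (i + 1)
  + (w (2 * i - 1)%:~R * gap_sum w k.+1 i 2 * A (i - 2)) *: v (i - 1)
  + drift w k i *: v i.
rewrite -{1}pE.
apply: (@polygon_curve_tangent n hn K v V (dimer_rate w k) (trimer_rate w k)) => //.
- move=> i; have An j : A (j + n%:Z) = A j by have [_ h _ _] := periodic_coefs vn j.
  have wn (j : int) : (2 * (j + n%:Z) - 1)%:~R = (2 * j - 1)%:~R :> Z2n.
    by rewrite !intrB index_period.
  have sh (j : int) : i + n%:Z + j = i + j + n%:Z by rewrite addrAC.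
  rewrite /V /drift /monomer_sum !sh.
  by rewrite !(gap_sum_periodic, An, wn, vn, index_period hn).
- move=> i; apply/rowP => j.
  have e1 : i + 2 - 1 = i + 1 by lia.
  have e2 : i + 2 + 1 = i + 3 by lia.
  have e3 : i + 2 - 2 = i by lia.
  have e4 : i + 1 - 1 = i by lia.
  have e5 : i + 1 + 1 = i + 2 by lia.
  have e6 : i + 1 - 2 = i - 1 by lia.
  have e7 : i - 1 - 1 = i - 2 by lia.
  have e8 : i - 1 - 2 = i - 3 by lia.
  have e9 : i - 1 + 1 = i by lia.
  have e10 : i + 1 + 2 = i + 3 by lia.
  have e11 : i - 1 + 2 = i + 1 by lia.
  have rec l : v (l + 2) 0 j = A l * v (l + 1) 0 j
      + w (2 * l)%:~R * A l * A (l - 1) * v l 0 j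
      + w (2 * l - 1)%:~R * A l * A (l - 1) * A (l - 2) * v (l - 1) 0 j.
    have /and4P[vl _ _ _] := gen l.
    by rewrite -wB -wC (recurrence vl) !mxE.
  have [I1 I2 I3] := flow_identities hn w k i.
  have := @deformation_coordinate K (A (i + 1)) (A i) (A (i - 1)) (A (i - 2)) (A (i - 3))
    (w (2 * (i + 1))%:~R) (w (2 * i)%:~R) (w (2 * (i - 1))%:~R)
    (w (2 * (i + 2) - 1)%:~R) (w (2 * (i + 1) - 1)%:~R)
    (w (2 * i - 1)%:~R) (w (2 * (i - 1) - 1)%:~R)
    (v (i + 3) 0 j) (v (i + 2) 0 j) (v (i + 1) 0 j)
    (v i 0 j) (v (i - 1) 0 j) (v (i - 2) 0 j).
  have R1 := rec (i + 1); have R0 := rec i; have Rm := rec (i - 1).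
  rewrite ?(e1, e2, e3, e4, e5, e6, e7, e8, e9, e10, e11) in R1 R0 Rm.
  move=> /(_ _ _ _ _ _ _ _ _ _ _ _ _ _ _ (A0 _) (A0 _) (A0 _) (A0 _)
    R1 R0 Rm I1 I2 I3) E.
  rewrite -[coefA v i]/(A i) wB wC /V !mxE.
  rewrite ?(e1, e2, e3, e4, e5, e6, e7, e8, e9, e10, e11).
  by move: E; rewrite ?mulrA => ->; ring.
- move=> i; have [-> ->] := hamiltonian_monodromy_sum hn k i p0.
  by rewrite (cor _).1 (cor _).2.
Qed.

Lemma tangent_zero p : closed_ngons p ->
  tangent_coordinates (@closed_ngons K n) p 0.
Proof.
move=> cp; exists (fun=> p); split=> //; first by near=> t.
by move=> j; rewrite mxE; exact: germ_cst.
Unshelve. all: by end_near. Qed.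

(** The logarithmic derivatives of a product over one parity class are constant on
each class, and the field only involves their differences at distance 4. *)
Lemma hamiltonian_parity_product (P : pred Z2n) p :
  (forall m : Z2n, P (m + 2) = P m) ->
  (forall m : Z2n, p 0 m != 0) ->
  hamiltonian_field (fun x : corner_space K n => \prod_(m | P m) x 0 m) p = 0.
Proof.
move=> P2 p0; set F := fun x => _.
have DE (i : Z2n) : 'D_(delta_mx 0 i) F p = (if P i then F p else 0) / p 0 i.
  apply: derive_affine => h.
  have pE j : (h *: delta_mx 0 i + p) 0 j = if j == i then p 0 i + h else p 0 j.
    rewrite !mxE eqxx /=; case: eqP => [->|_]; first by rewrite mulr1 addrC.
    by rewrite mulr0 add0r.
  have rest (Q : pred Z2n) : (forall j, Q j -> j != i) ->
      \prod_(j | Q j) (h *: delta_mx 0 i + p) 0 j = \prod_(j | Q j) p 0 j.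
    by move=> Qi; apply: eq_bigr => j /Qi/negPf ji; rewrite pE ji.
  rewrite /F /GRing.scale /=; case: ifP => [Pi|Pi].
    rewrite (bigD1 i) //= [\prod_(m | P m) p 0 m](bigD1 i) //=.
    rewrite rest; last by move=> j /andP[].
    by rewrite pE eqxx; field.
  by rewrite mul0r mulr0 addr0 rest // => j; apply: contraTneq => ->; rewrite Pi.
apply/rowP => j; rewrite (hamiltonian_fieldE hn j p0 DE) mxE.
have Pj : P (j - 2) = P j by rewrite -[in RHS](subrK 2 j) P2.
by rewrite Pj P2 subrr mulr0.
Qed.

End Tangency.

(** * Reversal of the orientation *)

Section Reversal.
Variables (n : nat) (hn : (5 <= n)%N) (K : numFieldType).
Local Notation Z2n := 'Z_(n.*2).
Implicit Types (m : Z2n) (x p : corner_space K n).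

(** The effect on corner indices of replacing v_i by v_{-i}. *)
Definition flip_index (m : Z2n) : Z2n := -1 - m.
Definition flip x : corner_space K n := \row_j x 0 (flip_index j).

Lemma flip_indexK : involutive flip_index.
Proof. by move=> m; rewrite /flip_index; ring. Qed.

Lemma flipK : involutive flip.
Proof. by move=> x; apply/rowP => m; rewrite !mxE flip_indexK. Qed.

Lemma odd_flip_index m : odd (flip_index m) = ~~ odd m.
Proof.
have om := @odd_indexD n hn m (flip_index m).
have -> : odd (flip_index m) = odd m (+) odd (m + flip_index m)%R.
  by rewrite om addbA addbb.
rewrite (_ : m + flip_index m = (-1)%:~R :> Z2n); last first.
  by rewrite /flip_index addrCA subrr addr0.
by rewrite odd_int // addbT.
Qed.

Lemma closed_flip x : closed_ngons x -> closed_ngons (flip x).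
Proof.
have n0 : (0 < n)%N by lia.
move=> /(closed_ngonsP _ n0)[v [vn gen cor]].
apply/(closed_ngonsP _ n0); exists (fun i => v (- i)).
have gen' : generic (fun i => v (- i)).
  move=> i; have [g1 g2 g3 g4] := gen (- i - 3).
  have rev (p q r : 'rV[K]_3) : noncollinear p q r = noncollinear r q p :> bool.
    rewrite !noncollinearE [det3 r q p](_ : _ = - det3 p q r) ?oppr_eq0 //.
    by rewrite /det3; ring.
  have e1 : - i - 3 + 1 = - (i + 2) by lia.
  have e2 : - i - 3 + 2 = - (i + 1) by lia.
  have e3 : - i - 3 + 3 = - i by lia.
  have e4 : - i - 3 = - (i + 3) by lia.
  rewrite e1 e2 e3 e4 in g1 g2 g3 g4.
  by split; rewrite rev.
split=> //.
- by move=> i; rewrite -[LHS]vn; congr v; lia.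
apply/(generic_corner_invariants _ gen') => i.
have /(generic_corner_invariants x gen)/(_ (- i))[h1 h2] := cor.
have e1 : - i - 2 = - (i + 2) by lia.
have e2 : - i - 1 = - (i + 1) by lia.
have e3 : - i + 1 = - (i - 1) by lia.
have e4 : - i + 2 = - (i - 2) by lia.
rewrite e1 e2 e3 e4 in h1 h2.
have f1 : flip_index (2 * i - 1)%:~R = (2 * - i)%:~R.
  by rewrite /flip_index -[-1]/((-1)%:~R) -intrB; congr _%:~R; lia.
have f2 : flip_index (2 * i)%:~R = (2 * - i - 1)%:~R.
  by rewrite /flip_index -[-1]/((-1)%:~R) -intrB; congr _%:~R; lia.
by rewrite !mxE f1 f2.
Qed.

Lemma tangent_flip p w : tangent_coordinates (@closed_ngons K n) p w ->
  tangent_coordinates (@closed_ngons K n) (flip p) (flip w).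
Proof.
move=> [gamma [g0 gS gg]]; exists (fun t => flip (gamma t)); split; first by rewrite g0.
  by apply: filterS gS => t; exact: closed_flip.
move=> j; apply: eq_germ (gg (flip_index j)) => [t|]; by rewrite mxE.
Qed.

End Reversal.

Section ReversedInvariants.
Variables (n : nat) (hn : (5 <= n)%N) (K : numFieldType).
Local Notation Z2n := 'Z_(n.*2).
Implicit Types (x p : corner_space K n) (F : corner_space K n -> K).
Implicit Types (A I J : {set Z2n}).

Lemma odd_add2 (m : Z2n) : odd (m + 2)%R = odd m.
Proof.
have o2 : odd (2 : Z2n)%R = false by exact: (odd_int hn 2).
by rewrite odd_indexD // o2 addbF.
Qed.

Lemma flip_index_inj : injective (@flip_index n).
Proof. exact: inv_inj (@flip_indexK n). Qed.

Lemma forall_in_flip A (P : pred Z2n) :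
  [forall m in @flip_index n @: A, P m] = [forall m in A, P (flip_index m)].
Proof.
apply/forall_inP/forall_inP => h m.
  by move=> mA; apply: h; exact: imset_f.
by move=> /imsetP[m' mA ->]; exact: h.
Qed.

Lemma admissible_flip I J :
  admissible true (@flip_index n @: I) (@flip_index n @: J) = admissible false I J.
Proof.
have sub a b : flip_index b - flip_index a = - (b - a) :> Z2n.
  by rewrite /flip_index; ring.
have d2 (d : Z2n) : (- d \in [:: 2; -2]) = (d \in [:: 2; -2]).
  by rewrite !inE !eqr_oppLR opprK orbC.
have d24 (d : Z2n) : (- d \in [:: 2; -2; 4; -4]) = (d \in [:: 2; -2; 4; -4]).
  by rewrite !inE !eqr_oppLR !opprK; do ?case: (_ == _).
have d13 (d : Z2n) : (- d \in [:: 1; -1; 3; -3]) = (d \in [:: 1; -1; 3; -3]).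
  by rewrite !inE !eqr_oppLR !opprK; do ?case: (_ == _).
rewrite /admissible !forall_in_flip.
congr [&& _, _, _, _ & _]; apply: eq_forallb_in => m _.
- by rewrite odd_flip_index //; case: (odd m).
- by rewrite odd_flip_index //; case: (odd m).
- by rewrite forall_in_flip; apply: eq_forallb_in => m' _; rewrite sub d24.
- by rewrite forall_in_flip; apply: eq_forallb_in => m' _; rewrite sub d2.
- by rewrite forall_in_flip; apply: eq_forallb_in => m' _; rewrite sub d13.
Qed.

Lemma monodromy_sum_flip k x : monodromy_sum false k x = monodromy_sum true k (flip x).
Proof.
pose f (A : {set Z2n}) := @flip_index n @: A.
have fK : involutive f.
  move=> A; rewrite /f -imset_comp -[RHS]imset_id; apply: eq_imset => m /=.
  by rewrite flip_indexK.
have f2K : involutive (fun IJ : {set Z2n} * {set Z2n} => (f IJ.1, f IJ.2)).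
  by case=> I J /=; rewrite !fK.
rewrite /monodromy_sum [RHS](reindex_inj (inv_inj f2K)) /=.
apply: eq_big => [[I J]|[I J] _] /=.
  by rewrite /f admissible_flip !card_imset //; exact: flip_index_inj.
rewrite /f card_imset; last exact: flip_index_inj.
rewrite !big_imset /=; try by move=> a b _ _; exact: flip_index_inj.
congr (_ * _ * _); apply: eq_bigr => m _; rewrite !mxE flip_indexK //.
rewrite (_ : flip_index (flip_index m - 1) = m + 1); last by rewrite /flip_index; ring.
rewrite (_ : flip_index (flip_index m + 1) = m - 1); last by rewrite /flip_index; ring.
ring.
Qed.

Lemma flip_delta i : flip (delta_mx 0 i) = delta_mx 0 (flip_index i) :> corner_space K n.
Proof. by apply/rowP => m; rewrite !mxE -(can_eq (@flip_indexK n)) flip_indexK. Qed.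

(** The flip reverses the order of i and i+2 and changes their parity; each of the
two changes the sign of the bracket. *)
Lemma coord_bracket_flip x i j :
  coord_bracket (flip x) (flip_index i) (flip_index j) = coord_bracket x i j.
Proof.
have m4 := small_index_neq0 hn (isT : (0 < `|4%:Z| < 10)%N).
rewrite /coord_bracket !mxE !flip_indexK.
have e1 (a b : Z2n) : (flip_index a == flip_index b + 2) = (b == a + 2) :> bool.
  have -> : flip_index b + 2 = flip_index (b - 2) by rewrite /flip_index; ring.
  by rewrite (inj_eq flip_index_inj) eq_sym subr_eq.
have sgn (m : Z2n) : (-1) ^+ m = (-1) ^+ odd m :> K by rewrite signr_odd.
rewrite !e1 !sgn !odd_flip_index //.
case: eqP => [iE|_]; case: eqP => [jE|_] //.
- move/eqP: iE; rewrite jE -addrA -subr_eq0 opprD addrA subrr sub0r oppr_eq0.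
  by rewrite [2 + 2](_ : _ = 4%:~R) ?m4 //; ring.
- rewrite iE odd_add2.
  by case: (odd j); rewrite /=; ring.
- rewrite jE odd_add2.
  by case: (odd i); rewrite /=; ring.
Qed.

Lemma hamiltonian_flip F x :
  hamiltonian_field (fun y => F (flip y)) x = flip (hamiltonian_field F (flip x)).
Proof.
have flip_add (h : K) d y : flip (h *: d + y) = h *: flip d + flip y :> corner_space K n.
  by apply/rowP => m; rewrite !mxE.
have dF G i y : 'D_(delta_mx 0 i) (fun z : corner_space K n => G (flip z) : K) y
    = 'D_(delta_mx 0 (flip_index i)) G (flip y).
  rewrite -flip_delta /derive.
  have E : (fun h : K => h^-1 *: (((fun z : corner_space K n => G (flip z) : K)
      \o shift y) (h *: delta_mx 0 i) - G (flip y)))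
    = (fun h : K => h^-1 *: ((G \o shift (flip y)) (h *: flip (delta_mx 0 i))
                             - G (flip y))).
    by apply/funext => h; rewrite /= flip_add.
  by rewrite E.
apply/rowP => j; rewrite !mxE /poisson.
have -> : (fun y : corner_space K n => y 0 j : K)
    = fun y => (fun z : corner_space K n => z 0 (flip_index j)) (flip y).
  by apply/funext => y; rewrite mxE flip_indexK.
rewrite [RHS](reindex_inj flip_index_inj) /=; apply: eq_bigr => i _.
rewrite [RHS](reindex_inj flip_index_inj) /=; apply: eq_bigr => m _.
by rewrite coord_bracket_flip (dF F) (dF (fun z => z 0 (flip_index j))).
Qed.

Lemma hamiltonian_fields_tangent_numField : hamiltonian_fields_tangent K n.
Proof.
move=> F FM p [cp _]; apply: tangent_coordinatesP.
have p0 := closed_neq0 hn cp.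
case: FM => [[|k] // _|[|k] // _||].
- have -> : @O_ K n k.+1 = fun x => monodromy_sum true k.+1 (flip x).
    by apply/funext => x; exact: monodromy_sum_flip.
  rewrite hamiltonian_flip -[p in tangent_coordinates _ p](flipK p).
  by apply: tangent_flip => //; apply: tangent_monodromy_sum => //; exact: closed_flip.
- exact: tangent_monodromy_sum.
- rewrite (@hamiltonian_parity_product n hn K (fun m => odd m)) //.
    exact: tangent_zero.
  exact: odd_add2.
- rewrite (@hamiltonian_parity_product n hn K (fun m => ~~ odd m)) //.
    exact: tangent_zero.
  by move=> m; rewrite odd_add2.
Qed.
End ReversedInvariants.

Theorem proposition3p1 (R : realType) (n : nat) (hn : (5 <= n)%N) :
  hamiltonian_fields_tangent R n /\ hamiltonian_fields_tangent R[i] n.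
Proof. by split; exact: hamiltonian_fields_tangent_numField. Qed.
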